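(* Let $r\ge 3$ be a fixed integer and let $G=G(n,r)$ be a random $r$-regular graph on $n$ vertices ($rn$ even). Then, with high probability as $n\to\infty$, $$rc(G)=\begin{cases}O(\log^4 n) & r=3,\\ O(\log^{2\theta_r} n) & r\ge 4,\end{cases}\qquad\text{where }\theta_r=\frac{\log(r-1)}{\log(r-2)}.$$ That is, there is a constant $C$ depending only on $r$ such that, with probability tending to $1$, $G$ is connected and $rc(G)\le C\log^4 n$ if $r=3$, respectively $rc(G)\le C(\log n)^{2\theta_r}$ if $r\ge4$.
   Context: $G(n,r)$ is a graph chosen uniformly at random from all simple $r$-regular graphs on vertex set $[n]=\{1,\dots,n\}$. An edge-colored graph (the coloring is arbitrary, not necessarily proper) is rainbow edge connected if any two vertices are joined by a path whose edges have pairwise distinct colors. For a connected graph $G$, the rainbow connectivity $rc(G)$ is the smallest number of colors in an edge coloring of $G$ that makes $G$ rainbow edge connected. ''With high probability'' means with probability tending to $1$ as $n\to\infty$ (over $n$ with $rn$ even). All logarithms are natural; $\log^a n$ means $(\log n)^a$. *)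

(* Defs.v *)
(* MathComp-Analysis.  The vertex set is 'I_n = {0, ..., n-1}, standing for
   {1, ..., n}.  A graph on a finite type V is given by its set of edges
   E : {set {set V}}; it is simple when every edge has exactly two elements. *)
From HB Require Import structures.
From mathcomp Require Import all_boot all_order all_algebra.
From mathcomp Require Import all_classical all_reals all_analysis.

Set Implicit Arguments.
Unset Strict Implicit.
Unset Printing Implicit Defensive.

Import Order.TTheory GRing.Theory Num.Theory.
Import numFieldNormedType.Exports.

Definition simple_graph (V : finType) (E : {set {set V}}) : bool :=
  [forall e in E, #|e| == 2].

Definition degree (V : finType) (E : {set {set V}}) (v : V) : nat :=
  #|[set e in E | v \in e]%SET|.

(* Irreflexive on simple graphs, since [set x; x] has one element. *)
Definition adj (V : finType) (E : {set {set V}}) : rel V :=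
  fun x y => [set x; y]%SET \in E.

Definition graph_connected (V : finType) (E : {set {set V}}) : bool :=
  [forall x, forall y, connect (adj E) x y].

(* The consecutive edges of the walk through the vertices x :: p. *)
Definition walk_edges (V : finType) (x : V) (p : seq V) : seq {set V} :=
  pairmap (fun u v => [set u; v]%SET) x p.

(* A colouring is a function on all sets of vertices; only its values on the
   edges of the graph are ever used. *)
Definition rainbow_connected (V : finType) (E : {set {set V}})
    (c : {set V} -> nat) : Prop :=
  forall x y : V, exists p : seq V,
    [/\ path (adj E) x p, last x p = y, uniq (x :: p)
      & uniq (map c (walk_edges x p))].

(* Colours are natural numbers below k rather than elements of 'I_k, so that
   an edgeless graph does have a colouring with 0 colours. *)
Definition rainbow_colorable (V : finType) (E : {set {set V}}) (k : nat) :
    Prop :=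
  exists c : {set V} -> nat,
    (forall e, e \in E -> c e < k) /\ rainbow_connected E c.

Lemma walk_edges_sub (V : finType) (x : V) (p : seq V) (e : {set V}) :
  e \in walk_edges x p -> {subset e <= x :: p}.
Proof.
elim: p x => [//|y p IHp] x; rewrite /walk_edges /= inE => /orP[/eqP->|he] v.
  by rewrite !inE => /orP[]->; rewrite ?orbT.
by move=> /(IHp _ he) hv; rewrite in_cons hv orbT.
Qed.

Lemma uniq_walk_edges (V : finType) (x : V) (p : seq V) :
  uniq (x :: p) -> uniq (walk_edges x p).
Proof.
elim: p x => [//|y p IHp] x /andP[xNp up].
rewrite /walk_edges /= (IHp _ up) andbT; apply/negP => /walk_edges_sub.
by move=> /(_ x); rewrite !inE eqxx => /(_ isT) xp; rewrite inE xp in xNp.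
Qed.

Lemma walk_edges_in (V : finType) (E : {set {set V}}) (x : V) (p : seq V) :
  path (adj E) x p -> {subset walk_edges x p <= E}.
Proof.
elim: p x => [//|y p IHp] x /= /andP[xy yp] e.
by rewrite inE => /orP[/eqP->//|]; apply: IHp.
Qed.

Lemma connected_rainbow_colorable (V : finType) (E : {set {set V}}) :
  graph_connected E -> rainbow_colorable E #|E|.
Proof.
move=> /forallP hE; exists (fun e => index e (enum E)); split.
  by move=> e eE; rewrite cardE index_mem mem_enum.
move=> x y; have /forallP /(_ y) /connectP[p pP ->] := hE x.
case/shortenP: pP => q qP uq _; exists q; split=> //.
rewrite map_inj_in_uniq ?uniq_walk_edges // => e f he hf hef.
by rewrite -(nth_index e (_ : e \in enum E)) ?hef ?nth_index //
           mem_enum (walk_edges_in qP).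
Qed.

Lemma rainbow_connectivity_exists (V : finType) (E : {set {set V}}) :
  exists k, graph_connected E ==> `[< rainbow_colorable E k >].
Proof.
exists #|E|; apply/implyP => hE.
exact/asboolP/connected_rainbow_colorable.
Qed.

(* For connected E, the least k such that k colours suffice; the junk value is
   0 when E is not connected. *)
Definition rainbow_connectivity (V : finType) (E : {set {set V}}) : nat :=
  ex_minn (rainbow_connectivity_exists E).

Definition regular_graphs (n r : nat) : {set {set {set 'I_n}}} :=
  [set E | simple_graph E && [forall v, degree E v == r]]%SET.

Local Open Scope ring_scope.

(* The probability that G(n, r), uniform on regular_graphs n r, satisfies Q;
   it is 0 when there is no r-regular graph on n vertices. *)
Definition Pr_regular (R : realType) (n r : nat) (Q : pred {set {set 'I_n}}) :
    R :=
  #|[set E in regular_graphs n r | Q E]%SET|%:R / #|regular_graphs n r|%:R.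

(* With high probability: n tends to infinity among those with r * n even. *)
Definition whp_regular (R : realType) (r : nat)
    (Q : forall n : nat, pred {set {set 'I_n}}) : Prop :=
  (Pr_regular R r (Q n) @[n --> within (fun n => ~~ odd (r * n)%N) \oo]
     --> (1 : R))%classic.

Definition theta (R : realType) (r : nat) : R :=
  ln (r%:R - 1) / ln (r%:R - 2).

Definition rc_rate (R : realType) (r n : nat) : R :=
  if (r == 3)%N then ln n%:R ^+ 4 else ln n%:R `^ (2 * theta R r).

(* Main.v *)
(* Random part.  Fix a set S of vertices.  Replacing an edge ux inside S and an
   edge vy outside S by uv and xy compares the number N_k of r-regular graphs
   with k edges between S and its complement to N_(k+2):
     N_k ((a - k) (b - k) - 2 k r^2) <= N_(k+2) (k+2) (k+1),
   where a = r |S| and b = r (n - |S|).  Up to lower order terms this says that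
   N_k^2 / ('C(a, k) 'C(b, k)) is nondecreasing along each parity class of k,
   so by Vandermonde's identity N_k^2 is at most R^2 'C(a, k) 'C(b, k) / 'C(a + b, a)
   up to polynomial factors, with R the total number of graphs; here
   'C(a + b, a) >= 'C(n, |S|)^r, which beats the 'C(n, |S|) choices of S because
   r > 2.  Hence, with high probability, every S with |S| <= n/2 sends out at
   least two edges and at least |S| / D edges, for a constant D.  Balls then grow
   geometrically, so the graph is 2-edge-connected of radius O(log n).

   Deterministic part.  A 2-edge-connected graph of radius rho has rainbow
   connectivity O(rho^2), and log^2 n is at most the claimed rate.  Suppose that
   a set D is already rainbow connected.  In a breadth-first forest towards D,
   each branch has an edge leaving it other than the one from its root to D;
   colour the branches with 3 colours so that this edge joins branches of
   different colours, and give a forest edge the colour (level, colour of its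
   branch) from a new palette.  Two vertices on the resulting ears of D in
   branches of the same colour reach D by disjoint sets of colours if the upper
   one goes up and the lower one goes down and out through the leaving edge.
   Adding these ears absorbs all the neighbours of D at the cost of 3 rho + 1
   colours, so rho rounds suffice. *)
Require Import Defs.
From HB Require Import structures.
From mathcomp Require Import all_boot all_order all_algebra.
From mathcomp Require Import all_classical all_reals all_analysis.

Set Implicit Arguments.
Unset Strict Implicit.
Unset Printing Implicit Defensive.

Import Order.TTheory GRing.Theory Num.Theory.
Import numFieldNormedType.Exports.
From mathcomp Require Import zify lra.

(** * Switchings *)

Lemma adjC (V : finType) (E : {set {set V}}) (x y : V) : adj E x y = adj E y x.
Proof. by rewrite /adj finset.setUC. Qed.

Lemma adj_neq (V : finType) (E : {set {set V}}) (x y : V) :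
  simple_graph E -> adj E x y -> x != y.
Proof.
move=> /forall_inP hE /hE; rewrite cards2.
by case: (x != y).
Qed.

Lemma degree_sum (V : finType) (E : {set {set V}}) (v : V) :
  simple_graph E -> degree E v = \sum_z (adj E v z : nat).
Proof.
move=> hE; rewrite -big_mkcond sum1dep_card /=.
rewrite -(card_in_imset (f := fun z => [set v; z]%SET)); last first.
  move=> z z'; rewrite !inE => hz hz' /setP /(_ z); rewrite !inE eqxx orbT.
  by rewrite eq_sym (negPf (adj_neq hE hz)) => /esym /eqP.
apply: eq_card => e; rewrite inE; apply/andP/imsetP => [[eE ve]|[z]].
  have e2 : #|e| == 2 by move/forall_inP: hE; apply.
  have /cards2P[x [y [_ exy]]] := e2.
  move: ve; rewrite exy !inE => /orP[] /eqP ->.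
    by exists y; rewrite // inE /adj -exy.
  by exists x; rewrite 1?finset.setUC // inE /adj finset.setUC -exy.
by rewrite inE => hz ->; rewrite set21.
Qed.

Lemma eq_set2 (V : finType) (w z a b : V) : a != b ->
  (([set w; z] == [set a; b])%SET : nat) =
  (w == a) * (z == b) + (w == b) * (z == a).
Proof.
move=> ab; have ba : (b == a) = false by rewrite eq_sym (negPf ab).
case: eqP => [e|ne].
  have /set2P hw : w \in [set a; b]%SET by rewrite -e set21.
  have /set2P ha : a \in [set w; z]%SET by rewrite e set21.
  have /set2P hb : b \in [set w; z]%SET by rewrite e set22.
  case: hw => hw; rewrite hw in ha hb *.
    case: hb => hb; first by rewrite hb eqxx in ab.
    by rewrite -hb !eqxx (negPf ab).
  case: ha => ha; first by rewrite ha eqxx in ab.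
  by rewrite -ha !eqxx ba.
have -> : (w == a) * (z == b) = 0.
  by rewrite mulnb; case: andP => // -[/eqP ? /eqP ?]; subst; case: ne.
rewrite mulnb; case: andP => // -[/eqP ? /eqP ?]; subst; case: ne.
by rewrite finset.setUC.
Qed.

Lemma sum_eq1 (V : finType) (P : pred V) (a : V) :
  \sum_(z | P z) (z == a : nat) = P a.
Proof.
by rewrite -big_mkcondr sum1_card; case: (boolP (P a)) => Pa;
   [rewrite (eq_card (B := pred1 a)) ?card1 // => z
   |rewrite eq_card0 // => z]; rewrite !unfold_in;
   case: eqP => [->|]; rewrite ?andbF ?Pa ?(negPf Pa).
Qed.

(** Each crossing edge is counted once, from its end in [S]. *)
Definition cut (V : finType) (E : {set {set V}}) (S : {set V}) : nat :=
  \sum_(u in S) \sum_(v in (~: S)%SET) adj E u v.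

Definition switch (V : finType) (u x v y : V) (E : {set {set V}}) :
    {set {set V}} :=
  ([set [set u; v]; [set x; y]] :|:
     (E :\: [set [set u; x]; [set v; y]]))%SET.

Section Switch.
Variables (V : finType) (u x v y : V) (E : {set {set V}}) (S : {set V}).
Hypotheses (uS : u \in S) (xS : x \in S) (vS : v \notin S) (yS : y \notin S).
Hypotheses (sE : simple_graph E) (ux : adj E u x) (vy : adj E v y).
Hypotheses (nuv : ~~ adj E u v) (nxy : ~~ adj E x y).

Let neqs : [/\ u != x, v != y, u != v & x != y].
Proof.
split; [exact: adj_neq ux|exact: adj_neq vy|by apply: contraNneq vS => <-|].
by apply: contraNneq yS => <-.
Qed.

(** Stated with sums so that no truncated subtraction occurs: summed over pairs it gives the effect
    on degrees and on the cut, and at a single [e] it recovers [E] from the switched graph. *)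
Lemma switch_mem (e : {set V}) :
  (e \in switch u x v y E) + (e == [set u; x]%SET) + (e == [set v; y]%SET) =
  (e \in E) + (e == [set u; v]%SET) + (e == [set x; y]%SET).
Proof.
have [nux nvy nuv' nxy'] := neqs.
rewrite /switch !inE.
have n1 : ([set u; x] == [set v; y])%SET = false.
  apply/negbTE/eqP => /setP/(_ u); rewrite !inE eqxx /= (negPf nuv') /=.
  by move/esym/eqP => uy; move: yS; rewrite -uy uS.
have n2 : ([set u; v] == [set x; y])%SET = false.
  apply/negbTE/eqP => /setP/(_ u); rewrite !inE eqxx /= (negPf nux) /=.
  by move/esym/eqP => uy; move: yS; rewrite -uy uS.
have n3 f g : f \in E -> g \notin E -> (g == f) = false.
  by move=> fE gE; apply: contraNF gE => /eqP ->.
have [-> | _] := eqVneq e ([set u; v])%SET.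
  by rewrite n2 !n3 //; move/negPf: nuv; rewrite /adj => ->.
have [-> | _] := eqVneq e ([set x; y])%SET.
  by rewrite !n3 //; move/negPf: nxy; rewrite /adj => ->.
have [-> | _] := eqVneq e ([set u; x])%SET; first by rewrite n1; move: ux; rewrite /adj => ->.
have [-> | _] := eqVneq e ([set v; y])%SET; rewrite /= ?addn0 //.
by move: vy; rewrite /adj => ->.
Qed.

Lemma simple_switch : simple_graph (switch u x v y E).
Proof.
have [nux nvy nuv' nxy'] := neqs.
apply/forall_inP => e; rewrite !inE => /orP[/orP[]/eqP->|/andP[_ eE]].
- by rewrite cards2 nuv'.
- by rewrite cards2 nxy'.
- by have /forall_inP := sE; apply.
Qed.

Lemma degree_switch (w : V) : degree (switch u x v y E) w = degree E w.
Proof.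
have [nux nvy nuv' nxy'] := neqs.
have H : forall a b, a != b ->
    \sum_z (([set w; z] == [set a; b])%SET : nat) = (w == a) + (w == b).
  move=> a b ab; under eq_bigr do rewrite eq_set2 //.
  by rewrite big_split /= -!big_distrr /= !sum_eq1 !muln1.
have : \sum_z ((adj (switch u x v y E) w z : nat) +
           ([set w; z] == [set u; x])%SET + ([set w; z] == [set v; y])%SET) =
       \sum_z ((adj E w z : nat) +
           ([set w; z] == [set u; v])%SET + ([set w; z] == [set x; y])%SET).
  by apply: eq_bigr => z _; exact: switch_mem.
rewrite !big_split /= !H // -!degree_sum ?simple_switch // => e.
by apply/eqP; rewrite -(eqn_add2r ((w == u) + (w == x) + (w == v) + (w == y)));
  apply/eqP; move: e; rewrite -!addnA => ->; congr (_ + (_ + _));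
  rewrite addnCA.
Qed.

(** Neither removed edge crosses between [S] and its complement, and both added edges do. *)
Lemma cut_switch : cut (switch u x v y E) S = cut E S + 2.
Proof.
have [nux nvy nuv' nxy'] := neqs.
have H : forall a b, a != b ->
    \sum_(w in S) \sum_(z in (~: S)%SET)
      (([set w; z] == [set a; b])%SET : nat) =
    (a \in S) * (b \notin S) + (b \in S) * (a \notin S).
  move=> a b ab.
  transitivity (\sum_(w in S) ((w == a) * (b \notin S) + (w == b) * (a \notin S))).
    apply: eq_bigr => w _; under eq_bigr do rewrite eq_set2 //.
    by rewrite big_split /= -!big_distrr /= !sum_eq1 !inE.
  by rewrite big_split /= -!big_distrl /= !sum_eq1.
have : \sum_(w in S) \sum_(z in (~: S)%SET) ((adj (switch u x v y E) w z : nat) +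
           ([set w; z] == [set u; x])%SET + ([set w; z] == [set v; y])%SET) =
       \sum_(w in S) \sum_(z in (~: S)%SET) ((adj E w z : nat) +
           ([set w; z] == [set u; v])%SET + ([set w; z] == [set x; y])%SET).
  by apply: eq_bigr => w _; apply: eq_bigr => z _; exact: switch_mem.
under eq_bigr do rewrite !big_split /=.
under [RHS]eq_bigr do rewrite !big_split /=.
rewrite !big_split /= !H // uS xS (negPf vS) (negPf yS) /=.
by rewrite -!/(cut _ _) !addn0 => ->; rewrite -addnA.
Qed.

End Switch.

(** [regular_graphs] over an arbitrary vertex type; on ['I_n] the two agree by conversion. *)
Definition regular (V : finType) (r : nat) : {set {set {set V}}} :=
  [set E | simple_graph E && [forall v, degree E v == r]]%SET.

Definition cut_class (V : finType) (r : nat) (S : {set V}) (k : nat) :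
    {set {set {set V}}} :=
  [set E in regular V r | cut E S == k]%SET.

Lemma regularP (V : finType) (r : nat) (E : {set {set V}}) :
  reflect (simple_graph E /\ forall v, \sum_z (adj E v z : nat) = r)
    (E \in regular V r).
Proof.
rewrite inE; apply: (iffP andP) => -[sE h]; split => //.
  by move=> v; rewrite -degree_sum //; apply/eqP/(forallP h).
by apply/forallP => v; rewrite degree_sum // h.
Qed.

(** By [switch_mem], the switching at fixed [u], [x], [v], [y] is injective. *)
Lemma card_switch (V : finType) (r k : nat) (S : {set V}) (u x v y : V) :
  u \in S -> x \in S -> v \notin S -> y \notin S ->
  #|[set E in cut_class r S k |
     [&& adj E u x, adj E v y, ~~ adj E u v & ~~ adj E x y]]%SET| <=
  #|[set E in cut_class r S k.+2 | [&& u != x, adj E u v & adj E x y]]%SET|.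
Proof.
move=> uS xS vS yS.
rewrite -(card_in_imset (f := switch u x v y)).
  apply/subset_leq_card/fintype.subsetP => E1 /imsetP[E + ->]; rewrite !inE.
  case/andP => /andP[/andP[sE dE] /eqP cE] /and4P[ux vy uv xy].
  rewrite (simple_switch uS xS vS yS sE ux vy).
  rewrite (cut_switch uS xS vS yS sE ux vy uv xy) cE addn2 eqxx andbT /=.
  rewrite (adj_neq sE ux) /adj !inE !eqxx ?orbT ?andbT /=.
  apply/forallP => w; rewrite (degree_switch uS xS vS yS sE ux vy uv xy).
  exact: (forallP dE).
move=> E1 E2; rewrite !inE.
case/andP => /andP[/andP[sE1 _] _] /and4P[ux1 vy1 uv1 xy1].
case/andP => /andP[/andP[sE2 _] _] /and4P[ux2 vy2 uv2 xy2] e12.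
apply/setP => e.
have := switch_mem uS xS vS yS sE1 ux1 vy1 uv1 xy1 e.
rewrite e12 (switch_mem uS xS vS yS sE2 ux2 vy2 uv2 xy2) => /eqP.
by rewrite !eqn_add2r; case: (_ \in _); case: (_ \in _).
Qed.

Section SwitchCount.
Variables (V : finType) (r : nat) (S : {set V}).

Let quad (F : V -> V -> V -> V -> nat) : nat :=
  \sum_(u in S) \sum_(v in (~: S)%SET) \sum_(x in S) \sum_(y in (~: S)%SET)
    F u v x y.

Let leq_quad F G :
  (forall u v x y, u \in S -> v \notin S -> x \in S -> y \notin S ->
     F u v x y <= G u v x y) -> quad F <= quad G.
Proof.
move=> FG; apply: leq_sum => u uS; apply: leq_sum => v; rewrite inE => vS.
by apply: leq_sum => x xS; apply: leq_sum => y; rewrite inE => yS; apply: FG.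
Qed.

Let exchange_quad (I : finType) (P : pred I) (F : I -> V -> V -> V -> V -> nat) :
  \sum_(i | P i) quad (F i) = quad (fun u v x y => \sum_(i | P i) F i u v x y).
Proof.
rewrite /quad exchange_big; apply: eq_bigr => u _.
rewrite exchange_big; apply: eq_bigr => v _.
rewrite exchange_big; apply: eq_bigr => x _.
by rewrite exchange_big.
Qed.

Let quadD F G H : quad (fun u v x y => F u v x y + G u v x y + H u v x y) =
  quad F + quad G + quad H.
Proof.
rewrite /quad -!big_split; apply: eq_bigr => u _.
rewrite -!big_split; apply: eq_bigr => v _.
rewrite -!big_split; apply: eq_bigr => x _.
by rewrite -!big_split.
Qed.

Section OneGraph.
Variables (E : {set {set V}}) (k : nat).
Hypothesis hE : E \in cut_class r S k.

Let sE : simple_graph E. Proof. by move: hE; rewrite !inE => /andP[/andP[]]. Qed.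
Let dE v : \sum_z (adj E v z : nat) = r.
Proof. by move: hE; rewrite inE => /andP[/regularP[_ ->]]. Qed.
Let cE : \sum_(u in S) \sum_(v in (~: S)%SET) adj E u v = k.
Proof. by move: hE; rewrite inE => /andP[_ /eqP]. Qed.

Let degree_split (u : V) :
  \sum_(x in S) adj E u x + \sum_(v in (~: S)%SET) adj E u v = r.
Proof.
rewrite -(dE u) [RHS](bigID (mem S)) /=; congr (_ + _).
by apply: eq_bigl => v; rewrite inE.
Qed.

Let inner_sum : \sum_(u in S) \sum_(x in S) adj E u x = r * #|S| - k.
Proof.
apply/eqP; rewrite -(eqn_add2r k) -{1}cE -big_split /=.
under eq_bigr do rewrite degree_split.
rewrite sum_nat_const mulnC subnK // -cE mulnC -sum_nat_const.
by apply: leq_sum => u _; rewrite -(degree_split u) leq_addl.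
Qed.

Let outer_sum :
  \sum_(v in (~: S)%SET) \sum_(y in (~: S)%SET) adj E v y =
  r * #|(~: S)%SET| - k.
Proof.
have cE' : \sum_(v in (~: S)%SET) \sum_(u in S) adj E v u = k.
  rewrite -cE exchange_big; apply: eq_bigr => u _.
  by apply: eq_bigr => v _; rewrite adjC.
apply/eqP; rewrite -(eqn_add2r k) -{1}cE' -big_split /=.
under eq_bigr do rewrite addnC degree_split.
rewrite sum_nat_const mulnC subnK // -cE' mulnC -sum_nat_const.
by apply: leq_sum => v _; rewrite -(degree_split v) leq_addr.
Qed.

Let half_sum (P : pred V) (u : V) : \sum_(x | P x) adj E u x <= r.
Proof. by rewrite -(dE u) [leqRHS](bigID P) leq_addr. Qed.

(** There are [r * #|S| - k] ordered adjacent pairs inside [S], and similarly outside. An existing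
    edge [uv] spoils at most [k * r ^ 2] choices: a crossing edge, then a neighbour of each end;
    likewise [xy]. *)
Lemma switch_forward :
  (r * #|S| - k) * (r * #|(~: S)%SET| - k) - 2 * k * r ^ 2 <=
  quad (fun u v x y =>
    [&& adj E u x, adj E v y, ~~ adj E u v & ~~ adj E x y] : nat).
Proof.
set Q := quad _.
pose B1 u v x y := adj E u v * (adj E u x * adj E v y).
pose B2 u v x y := adj E x y * (adj E u x * adj E v y).
have hB1 : quad B1 <= k * r ^ 2.
  rewrite -cE big_distrl; apply: leq_sum => u _.
  rewrite big_distrl; apply: leq_sum => v _.
  under eq_bigr do rewrite -!big_distrr /=.
  rewrite -!big_distrr -big_distrl /= leq_mul2l.
  by apply/orP; right; rewrite expnS expn1 leq_mul.
have hB2 : quad B2 <= k * r ^ 2.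
  (* Exchanging [u] with [x] and [v] with [y] turns [B2] into [B1]. *)
  have -> : quad B2 = quad B1.
    rewrite /quad.
    under eq_bigr do rewrite exchange_big /=.
    rewrite exchange_big; apply: eq_bigr => u _.
    transitivity (\sum_(i in S) \sum_(j in (~: S)%SET) \sum_(v in (~: S)%SET) B2 i v u j).
      by apply: eq_bigr => i _; rewrite exchange_big.
    rewrite exchange_big; apply: eq_bigr => v _.
    apply: eq_bigr => i _; apply: eq_bigr => j _.
    by rewrite /B1 /B2 (adjC E i u) (adjC E j v).
  exact: hB1.
rewrite leq_subLR.
apply: (@leq_trans (Q + quad B1 + quad B2)).
  have -> : (r * #|S| - k) * (r * #|(~: S)%SET| - k) =
      quad (fun u v x y => adj E u x * adj E v y).
    rewrite -inner_sum -outer_sum big_distrl; apply: eq_bigr => u _ /=.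
    rewrite mulnC big_distrl; apply: eq_bigr => v _ /=.
    rewrite mulnC big_distrl; apply: eq_bigr => x _ /=.
    by rewrite -big_distrr.
  rewrite -quadD; apply: leq_quad => u v x y _ _ _ _.
  rewrite /B1 /B2.
  by case: (adj E u x); case: (adj E v y); case: (adj E u v); case: (adj E x y).
by rewrite -addnA addnC leq_add2r -mulnA mul2n -addnn leq_add.
Qed.

Lemma switch_backward :
  quad (fun u v x y => [&& u != x, adj E u v & adj E x y] : nat) <= k * k.-1.
Proof.
rewrite -{1}cE big_distrl; apply: leq_sum => u uS.
rewrite big_distrl; apply: leq_sum => v vS /=.
case uv : (adj E u v); last first.
  by rewrite !big1 // => x _; rewrite big1 // => y _; rewrite andbF.
rewrite mul1n -ltnS.
have k0 : 0 < k by rewrite -cE (bigD1 u) //= (bigD1 v) //= uv.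
(* The inequality is strict because the crossing edge [uv] counts towards [k] but is excluded on the
   left by [u != x]. *)
rewrite prednK // -cE [leqRHS](bigD1 u) //= [X in X < _](bigD1 u) //=.
rewrite -addSn leq_add //.
  rewrite big1 => [|y _]; last by rewrite eqxx.
  by rewrite (bigD1 v) //= uv.
apply: leq_sum => x _; apply: leq_sum => y _.
by rewrite andbC; case: (adj E x y); rewrite //= leq_b1.
Qed.

End OneGraph.

Lemma switch_count (k : nat) :
  #|cut_class r S k| *
    ((r * #|S| - k) * (r * #|(~: S)%SET| - k) - 2 * k * r ^ 2) <=
  #|cut_class r S k.+2| * (k.+2 * k.+1).
Proof.
rewrite -!sum_nat_const.
apply: (@leq_trans (\sum_(E in cut_class r S k) quad (fun u v x y =>
    [&& adj E u x, adj E v y, ~~ adj E u v & ~~ adj E x y] : nat))).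
  by apply: leq_sum => E hE; exact: switch_forward.
apply: (@leq_trans (\sum_(E in cut_class r S k.+2) quad (fun u v x y =>
    [&& u != x, adj E u v & adj E x y] : nat))); last first.
  by apply: leq_sum => E hE; apply: (switch_backward hE).
rewrite !exchange_quad; apply: leq_quad => u v x y uS vS xS yS.
rewrite -!big_mkcondr !sum1_card.
have := card_switch r k uS xS vS yS.
by rewrite !cardsE.
Qed.

End SwitchCount.

(** * Estimates for the numbers of graphs with a given cut *)

Section SmallSets.
Variables (a b c n R : nat) (N : nat -> nat).
Hypothesis NR : forall k, N k <= R.
Hypothesis step : forall k, N k * ((a - k) * (b - k) - 2 * k * c) <= N k.+2 * (k.+2 * k.+1).

(** For k < a the first hypothesis makes the bracket in [step] at least [n], so each step of two
    gains a factor n / (a + 2)^2. The bound on [k + 2 * j] keeps all [j] starting indices below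
    [a]. *)
Lemma small_chain (k j : nat) : n + a + 2 * a * c <= b -> k + 2 * j <= a.+1 ->
  n ^ j * N k <= (a.+2 ^ 2) ^ j * R.
Proof.
move=> hn; elim: j k => [|j IHj] k hk; first by rewrite !mul1n.
have ka : k < a by lia.
have h1 : N k * n <= N k.+2 * a.+2 ^ 2.
  apply: leq_trans (leq_trans (step k) _); rewrite leq_mul2l.
    apply/orP; right.
    have : b - k <= (a - k) * (b - k) by rewrite leq_pmull // subn_gt0.
    have : 2 * k * c <= 2 * a * c by rewrite leq_mul // leq_mul // ltnW.
    lia.
  by apply/orP; right; rewrite expnS expn1 leq_mul //; lia.
have := IHj k.+2 _; rewrite addSn addSn -addnS -addnS => /(_ ltac:(lia)) IH.
move: h1 IH; set C := a.+2 ^ 2; set X := n ^ j; set Y := C ^ j => h1 IH.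
rewrite !expnS -/X -/Y (_ : n * X * N k = X * (N k * n)); last by lia.
apply: (@leq_trans (X * (N k.+2 * C))); first by rewrite leq_mul2l h1 orbT.
rewrite (_ : C * Y * R = Y * R * C); last by lia.
by rewrite mulnA leq_mul2r IH orbT.
Qed.
End SmallSets.

Lemma leq_bin_mul (m1 m2 j1 j2 : nat) :
  'C(m1, j1) * 'C(m2, j2) <= 'C(m1 + m2, j1 + j2).
Proof.
have hj : j1 < (j1 + j2).+1 by rewrite ltnS leq_addr.
rewrite -binomial.Vandermonde (bigD1 (Ordinal hj)) //=.
by rewrite addKn leq_addr.
Qed.

Lemma leq_bin_exp (n s q : nat) : 'C(n, s) ^ q <= 'C(q * n, q * s).
Proof.
elim: q => [|q IHq]; first by rewrite !mul0n bin0.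
by rewrite expnS !mulSn (leq_trans _ (leq_bin_mul _ _ _ _)) // leq_mul2l IHq orbT.
Qed.

(** Each factor (m - i) / (j - i) of the binomial coefficient is at least m / j, hence at least n /
    s. *)
Lemma bin_ratio (n s m j : nat) : s <= n -> j <= m -> n * j <= m * s ->
  n ^ j <= 'C(m, j) * s ^ j.
Proof.
move=> sn; elim: j m => [|j IHj] m; first by rewrite bin0.
case: m => // m jm h.
have := IHj m jm ltac:(nia) => {}IHj.
rewrite -(leq_pmul2l (ltn0Sn j)) mulnA -mul_bin_diag !expnS.
apply: (@leq_trans (m.+1 * s * ('C(m, j) * s ^ j))).
  by rewrite mulnA [j.+1 * n]mulnC leq_mul.
by rewrite -!mulnA leq_mul2l mulnCA leqnn orbT.
Qed.

Lemma leq_expl (m n k : nat) : m <= n -> m ^ k <= n ^ k.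
Proof. by case: k => // k mn; rewrite leq_exp2r. Qed.

Lemma ffact_leq_exp (n m : nat) : n ^_ m <= n ^ m.
Proof.
elim: m n => [|m IHm] n //; rewrite ffactnS expnS leq_mul2l.
by rewrite (leq_trans (IHm _)) ?orbT // leq_expl // leq_pred.
Qed.

Lemma exp_leq_fact (h i : nat) : i <= h -> h ^ i <= 4 ^ h * i`!.
Proof.
move=> ih; apply: (@leq_trans ('C(h + i, i) * i`!)).
  rewrite bin_ffact; elim: i {ih} => [|i IHi] //.
  by rewrite addnS ffactSS expnS leq_mul // leqW // leq_addr.
rewrite leq_mul2r; apply/orP; right.
rewrite (_ : 4 = 2 ^ 2) // -expnM mul2n -addnn.
apply: (@leq_trans (2 ^ (h + i))); last by rewrite leq_exp2l // leq_add2l.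
have hi : i < (h + i).+1 by rewrite ltnS leq_addl.
rewrite -[2]/(1 + 1) Pascal (bigD1 (Ordinal hi)) //= !exp1n !muln1.
exact: leq_addr.
Qed.

Lemma leq_exp2 (m : nat) : m <= 2 ^ m.
Proof. exact/ltnW/ltn_expl. Qed.

(** By [exp_leq_fact], ['C(m, i)] times (s / n)^i is at most (16 r)^i 4^h, and 8 r i <= h makes (16
    r)^i at most 4^h. The other h - i factors s / n are at most 1. *)
Lemma bin_small_index (r n s i m h : nat) : s <= 16 * h -> s <= n -> m <= r * n ->
  8 * r * i <= h -> i <= h -> 'C(m, i) * s ^ h <= n ^ h * 2 ^ (4 * h).
Proof.
move=> sh sn mn rih ih.
have hi : 'C(m, i) * h ^ i <= (r * n) ^ i * 4 ^ h.
  have f1 : 'C(m, i) * i`! <= (r * n) ^ i.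
    by rewrite bin_ffact (leq_trans (ffact_leq_exp _ _)) // leq_expl.
  rewrite -(leq_pmul2r (fact_gt0 i)) mulnAC.
  by apply: (leq_trans (leq_mul f1 (exp_leq_fact ih))); rewrite mulnA.
have si : 'C(m, i) * s ^ i <= n ^ i * 2 ^ (4 * h).
  apply: (@leq_trans ('C(m, i) * (16 * h) ^ i)).
    by rewrite leq_mul2l leq_expl ?orbT.
  rewrite expnMn mulnCA.
  apply: (@leq_trans (16 ^ i * ((r * n) ^ i * 4 ^ h))); first by rewrite leq_mul2l hi orbT.
  rewrite mulnA -expnMn mulnA expnMn [(16 * r) ^ i * _]mulnC -mulnA leq_mul2l.
  apply/orP; right.
  rewrite expnM (_ : 2 ^ 4 = 4 * 4) // (expnMn 4 4) leq_mul2r; apply/orP; right.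
  apply: (@leq_trans ((2 ^ (16 * r)) ^ i)).
    exact/leq_expl/leq_exp2.
  by rewrite (_ : 4 = 2 ^ 2) // -!expnM leq_exp2l //; lia.
have split_exp x : x ^ h = x ^ i * x ^ (h - i) by rewrite -expnD subnKC.
rewrite (split_exp s) (split_exp n) mulnA [leqRHS]mulnAC leq_mul //.
exact: leq_expl.
Qed.

Section LargeSets.
Variables (r n s R : nat) (N : nat -> nat).
Hypotheses (hr : 3 <= r) (NR : forall k, N k <= R).
Hypothesis step : forall k,
  N k * ((r * s - k) * (r * (n - s) - k) - 2 * k * r ^ 2) <=
  N k.+2 * (k.+2 * k.+1).
Hypotheses (hs : 512 * r ^ 3 <= s) (hn : 2 * s <= n).

(** An eighth leaves room in the final count: [large_bound] gains s - h >= 7 h factors n / s, and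
    [W_bound] loses at most h + 4 h of them, leaving 2 h. *)
Let h := s %/ 8.
Let a := r * s - h.
Let b := r * (n - s) - h.
Let W k := 'C(a, k) * 'C(b, k).

Let hs8 : 8 * h <= s. Proof. by rewrite mulnC leq_divM. Qed.
Let h_ge : 64 * r ^ 3 <= h. Proof. rewrite /h; lia. Qed.
Let s_le : s <= 16 * h.
Proof.
have : 0 < r ^ 3 by rewrite expn_gt0; lia.
move: h_ge; rewrite /h; lia.
Qed.

(* Shortening both sides by h absorbs the error term 2kr^2, which makes the
   ratio of consecutive terms exactly that of products of binomials. *)
Let step' k : N k * ((a - k) * (b - k)) <= N k.+2 * (k.+2 * k.+1).
Proof.
apply: leq_trans (step k); rewrite leq_mul2l; apply/orP; right.
have [ka|ka] := leqP a k; first by rewrite (eqP ka).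
have : 2 * k * r ^ 2 <= h * h.
  have : k <= r * (16 * h).
    by move: ka; rewrite /a; have := leq_mul (leqnn r) s_le; lia.
  move=> /(leq_mul (leqnn 2)) /leq_mul /(_ (leqnn (r ^ 2))) /leq_trans; apply.
  have -> : 2 * (r * (16 * h)) * r ^ 2 = 32 * r ^ 3 * h.
    by rewrite !expnS expn0; lia.
  by rewrite leq_mul2r (leq_trans _ h_ge) ?orbT // leq_mul2r orbT.
have : r * s <= r * (n - s) by rewrite leq_mul2l; lia.
have : s <= r * s by rewrite leq_pmull //; lia.
rewrite /a /b in ka *; set A := r * s in ka *; set B := r * (n - s).
set X := 2 * k * r ^ 2; move=> sA AB hX.
have -> : (A - k) * (B - k) = (A - h - k + h) * (B - h - k + h).
  by congr (_ * _); lia.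
have : h <= B - h - k + (A - h - k) + h by lia.
set p := A - h - k; set q := B - h - k => hpq.
nia.
Qed.

(** The square of [step'], combined with the bound (m - k)^2 / ((k + 2)(k + 1)) for the ratio of
    ['C(m, k.+2)] to ['C(m, k)]. *)
Let W_step k : N k ^ 2 * W k.+2 <= N k.+2 ^ 2 * W k.
Proof.
have hbin m : 'C(m, k.+2) * (k.+2 * k.+1) <= (m - k) ^ 2 * 'C(m, k).
  rewrite mulnC -mulnA mulnCA mul_bin_left mulnCA mul_bin_left mulnA.
  rewrite leq_mul2r; apply/orP; right; rewrite expnS expn1.
  by rewrite leq_mul2r leq_sub2l ?orbT.
have hq : 0 < (k.+2 * k.+1) ^ 2 by [].
rewrite -(leq_pmul2r hq) /W.
apply: (@leq_trans (N k ^ 2 * (((a - k) ^ 2 * 'C(a, k)) * ((b - k) ^ 2 * 'C(b, k))))).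
  rewrite -mulnA leq_mul2l; apply/orP; right.
  by rewrite [(k.+2 * _) ^ 2]expnS expn1 mulnACA; apply: leq_mul.
have := leq_mul (step' k) (step' k); rewrite !mulnn.
set X := 'C(a, k); set Y := 'C(b, k) => hX.
have -> : N k ^ 2 * ((a - k) ^ 2 * X * ((b - k) ^ 2 * Y)) =
          (N k * ((a - k) * (b - k))) ^ 2 * (X * Y).
  by rewrite !expnMn; clear; lia.
have -> : N k.+2 ^ 2 * (X * Y) * (k.+2 * k.+1) ^ 2 =
          (N k.+2 * (k.+2 * k.+1)) ^ 2 * (X * Y).
  by rewrite [in RHS]expnMn; clear; lia.
by rewrite leq_mul2r hX orbT.
Qed.

Let W_chain k j : N k ^ 2 * W (k + 2 * j) <= R ^ 2 * W k.
Proof.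
elim: j k => [|j IHj] k; first by rewrite addn0 leq_mul2r leq_exp2r ?NR ?orbT.
have := IHj k.+2; rewrite (_ : k.+2 + 2 * j = k + 2 * j.+1); last by lia.
set K := _ + _ => IH.
(* If [W k.+2] vanishes then so does [W K], and the inequality is trivial. *)
have [W0|W0] := posnP (W k.+2).
  have [->|] := posnP (W K); first by rewrite muln0.
  move: W0 => /eqP; rewrite -leqn0 leqNgt /W !muln_gt0 !bin_gt0 /K.
  by move=> /negP W0 WK; case: W0; lia.
rewrite -(leq_pmul2r W0).
have := W_step k => h1.
apply: (@leq_trans (N k.+2 ^ 2 * W k * W K)); first by rewrite mulnAC leq_mul2r h1 orbT.
by rewrite mulnAC [leqRHS]mulnAC leq_mul2r IH orbT.
Qed.

Let r0 : 0 < r. Proof. lia. Qed.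
Let h0 : 0 < h.
Proof. by apply: leq_trans h_ge; rewrite muln_gt0 expn_gt0 r0. Qed.
Let s0 : 0 < s. Proof. by apply: leq_trans hs8; rewrite muln_gt0 h0. Qed.
Let sr : s <= r * s. Proof. by rewrite leq_pmull. Qed.
Let rsn : r * s <= r * (n - s). Proof. by rewrite leq_mul2l; lia. Qed.
Let rns : r * (n - s) + r * s = r * n. Proof. by rewrite -mulnDr subnK //; lia. Qed.

Let W_bound k : 256 * r * k <= s -> W k * s ^ h <= n ^ h * 2 ^ (4 * h).
Proof.
move=> hk.
have hk' : 16 * (r * k) <= h by lia.
have kr : k <= r * k by rewrite leq_pmull.
apply: (@leq_trans ('C(a + b, 2 * k) * s ^ h)).
  by rewrite leq_mul2r mul2n -addnn leq_bin_mul orbT.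
apply: (@bin_small_index r) => //; [lia| |lia|lia].
by rewrite -rns addnC leq_add // leq_subr.
Qed.

Let binS_le m k : 'C(m, k.+1) <= m * 'C(m, k).
Proof.
apply: (@leq_trans (k.+1 * 'C(m, k.+1))); first by rewrite leq_pmull.
by rewrite mul_bin_left leq_mul2r leq_subr orbT.
Qed.

(** Three cases: for K < k the factor [W K] is small by itself; for K >= k of the same parity
    [W_chain] reduces it to [W k]; for the other parity one index more is spent, at the cost of the
    factor [r * s * (r * n)]. *)
Let term_bound k K : 256 * r * k <= s ->
  N k ^ 2 * (W K * s ^ h) <=
  R ^ 2 * (n ^ h * 2 ^ (4 * h)) * (r * s * (r * n)).
Proof.
move=> hk.
have q0 : 0 < r * s * (r * n) by rewrite !muln_gt0 r0 s0 /=; lia.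
have NkR : N k ^ 2 <= R ^ 2 by exact: leq_expl.
have [Kk|kK] := ltnP K k.
  apply: leq_trans (leq_pmulr _ q0); apply: leq_mul => //.
  apply: W_bound; apply: leq_trans hk; rewrite leq_mul2l ltnW ?orbT //.
have {kK} [j ->] : exists j, K = k + j by exists (K - k); rewrite subnKC.
rewrite -(odd_double_half j); set i := j./2.
have evenK : N k ^ 2 * (W (k + i.*2) * s ^ h) <= R ^ 2 * (n ^ h * 2 ^ (4 * h)).
  rewrite mulnA -mul2n; apply: leq_trans (leq_mul (W_chain k i) (leqnn _)) _.
  by rewrite -mulnA leq_mul2l W_bound ?orbT.
case: (odd j); last by rewrite add0n; apply: leq_trans evenK _; rewrite leq_pmulr.
rewrite addnCA add1n.
apply: (@leq_trans (N k ^ 2 * (W (k + i.*2) * s ^ h) * (r * s * (r * n)))); last first.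
  by rewrite leq_mul2r evenK orbT.
set m := k + _; set q := r * s * (r * n).
have hW : W m.+1 <= W m * q.
  apply: leq_trans (leq_mul (binS_le a m) (binS_le b m)) _.
  rewrite mulnACA mulnC leq_mul2l; apply/orP; right.
  rewrite /q; apply: leq_mul; first exact: leq_subr.
  by rewrite -rns (leq_trans (leq_subr _ _)) // leq_addr.
rewrite -mulnA leq_mul2l [W m * _ * q]mulnAC leq_mul2r.
by rewrite hW !orbT.
Qed.

(** Summed over K, [term_bound] bounds ['C(b + a, a)] by Vandermonde's identity. This coefficient
    absorbs the square of ['C(n, s)] because r - 1 >= 2, and the spare ['C(n - 2 * h, s - h)]
    provides the decay in s / n. *)
Lemma large_bound k : 256 * r * k <= s ->
  ('C(n, s) * N k) ^ 2 * n ^ (2 * h) <= R ^ 2 * (r ^ 3 * n ^ 3) * s ^ (2 * h).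
Proof.
move=> hk.
have n0 : 0 < n by lia.
have sn : s <= n by lia.
pose e := s - 8 * h.
have she : s - h = 7 * h + e by rewrite /e; lia.
have e5 : 5 * h = h + 4 * h by lia.
have e7 : 7 * h + e = 2 * h + (5 * h + e) by lia.
(* The condition n (s - h) <= (n - 2 h) s of [bin_ratio] follows from 2 s <= n. *)
have hB : n ^ (s - h) <= 'C(n - 2 * h, s - h) * s ^ (s - h).
  apply: bin_ratio; [lia|lia|].
  by rewrite mulnBr mulnBl leq_sub2l // mulnAC leq_mul2r hn orbT.
have hC : 'C(n, s) ^ 2 * 'C(n - 2 * h, s - h) <= 'C(b + a, a).
  have -> : b + a = (r.-1 * n) + (n - 2 * h).
    have : r * n = r.-1 * n + n by rewrite -{1}(prednK r0) mulSn addnC.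
    rewrite /a /b -rns; lia.
  have -> : a = r.-1 * s + (s - h).
    have : r * s = r.-1 * s + s by rewrite -{1}(prednK r0) mulSn addnC.
    rewrite /a; lia.
  apply: leq_trans (leq_bin_mul _ _ _ _); rewrite leq_mul2r; apply/orP; right.
  apply: leq_trans (leq_bin_exp _ _ _); rewrite leq_pexp2l ?bin_gt0 //; lia.
have sum_bound : N k ^ 2 * 'C(b + a, a) * s ^ h <=
    R ^ 2 * (n ^ h * 2 ^ (4 * h)) * (r ^ 3 * n ^ 3).
  rewrite -binomial.Vandermonde big_distrr big_distrl /=.
  apply: (@leq_trans (\sum_(j < a.+1)
      R ^ 2 * (n ^ h * 2 ^ (4 * h)) * (r * s * (r * n)))).
    apply: leq_sum => j _.
    have ja : j <= a by rewrite -ltnS.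
    rewrite bin_sub // [_ * 'C(a, j)]mulnC -mulnA; exact: term_bound.
  rewrite sum_nat_const card_ord mulnC -mulnA leq_mul2l; apply/orP; right.
  have a1 : a.+1 <= r * n by rewrite -rns /a; lia.
  have rsrn : r * s <= r * n by rewrite -rns leq_addl.
  have -> : r ^ 3 * n ^ 3 = (r * n) * (r * n) * (r * n) by rewrite !expnS !expn0; lia.
  by do 2!apply: leq_mul => //.
rewrite she in hB hC.
set B := 'C(n - 2 * h, _) in hB hC.
pose X := ('C(n, s) * N k) ^ 2; pose Y := R ^ 2 * (r ^ 3 * n ^ 3).
have h1 : X * B * s ^ h <= Y * n ^ h * 2 ^ (4 * h).
  have -> : Y * n ^ h * 2 ^ (4 * h) = R ^ 2 * (n ^ h * 2 ^ (4 * h)) * (r ^ 3 * n ^ 3).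
    by rewrite /Y; move: (_ ^ h) (2 ^ _) (r ^ 3 * _) => *; clear; lia.
  apply: leq_trans sum_bound; rewrite leq_mul2r; apply/orP; right.
  by rewrite /X expnMn mulnAC mulnC leq_mul2l hC orbT.
(* As 2 <= n / s, the loss 2^(4 h) costs at most 4 h factors n / s. *)
have h2 : 2 ^ (4 * h) * s ^ (4 * h) <= n ^ (4 * h).
  by rewrite -expnMn leq_expl.
rewrite -/X -/Y.
have h3 : X * n ^ (7 * h + e) * s ^ (5 * h) <= Y * n ^ (5 * h) * s ^ (7 * h + e).
  apply: (@leq_trans (X * (B * s ^ (7 * h + e)) * s ^ (5 * h))).
    by rewrite leq_mul2r leq_mul2l hB !orbT.
  have -> : X * (B * s ^ (7 * h + e)) * s ^ (5 * h) =
            (X * B * s ^ h) * (s ^ (4 * h) * s ^ (7 * h + e)).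
    by rewrite e5 (expnD s h); move: (s ^ h) (s ^ (4 * h)) (s ^ _) => *; clear; lia.
  apply: leq_trans (leq_mul h1 (leqnn _)) _.
  have -> : Y * n ^ h * 2 ^ (4 * h) * (s ^ (4 * h) * s ^ (7 * h + e)) =
            Y * n ^ h * (2 ^ (4 * h) * s ^ (4 * h)) * s ^ (7 * h + e).
    by move: (n ^ h) (2 ^ _) (s ^ (4 * h)) (s ^ _) => *; clear; lia.
  rewrite leq_mul2r; apply/orP; right.
  by rewrite e5 (expnD n h) [Y * (_ * _)]mulnA leq_mul2l h2 orbT.
have p0 : 0 < n ^ (5 * h) * s ^ (5 * h) * n ^ e.
  by rewrite !muln_gt0 !expn_gt0 n0 s0.
rewrite -(leq_pmul2r p0).
have -> : X * n ^ (2 * h) * (n ^ (5 * h) * s ^ (5 * h) * n ^ e) =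
          X * n ^ (7 * h + e) * s ^ (5 * h).
  rewrite e7 (expnD n (2 * h)) (expnD n (5 * h)).
  by move: (n ^ (2 * h)) (n ^ (5 * h)) (s ^ _) (n ^ e) => *; clear; lia.
apply: leq_trans h3 _.
rewrite e7 (expnD s (2 * h)) (expnD s (5 * h)).
have -> : Y * n ^ (5 * h) * (s ^ (2 * h) * (s ^ (5 * h) * s ^ e)) =
          Y * s ^ (2 * h) * (n ^ (5 * h) * s ^ (5 * h) * s ^ e).
  by move: (n ^ (5 * h)) (s ^ (2 * h)) (s ^ (5 * h)) (s ^ e) => *; clear; lia.
by rewrite !leq_mul2l leq_expl ?orbT.
Qed.

End LargeSets.

(** * Expansion of random regular graphs *)

(** Split h into d + 1 blocks of length j: d of them pay for h^d up to a constant, and the last one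
    pays for that constant. *)
Lemma poly_leq_exp2 (c d : nat) :
  exists h0, forall h, h0 <= h -> c * h ^ d <= 2 ^ h.
Proof.
pose q := d.+1; exists (q * (c * q ^ d)) => h hh.
have hj : h <= q * (h %/ q).+1 by rewrite mulnC ltnW // ltn_ceil.
have jh : c * q ^ d <= h %/ q by rewrite leq_divRL // mulnC.
move: (h %/ q) hj jh (leq_divM h q) => j hj jh hq.
apply: (@leq_trans (2 ^ (j * q))); last by rewrite leq_exp2l.
rewrite mulnS expnD.
apply: (@leq_trans (c * (q ^ d * 2 ^ (j * d)))).
  rewrite leq_mul2l; apply/orP; right; apply: leq_trans (leq_expl _ hj) _.
  by rewrite expnMn leq_mul2l expnM leq_expl ?orbT // ltn_expl.
by rewrite mulnA leq_mul2r (leq_trans jh) ?orbT // leq_exp2.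
Qed.

(** The exponent 9 is 3 from [large_bound] plus 6, so that after a square root each pair of a size
    and a cut has probability at most n^-3. If s^2 <= n, then (s^2)^h <= n^h with h >= 10; otherwise
    n <= 256 h^2 and a power of 2 beats the polynomial. *)
Lemma large_numeric (r : nat) : 3 <= r -> exists n0, forall n s,
  n0 <= n -> 512 * r ^ 3 <= s -> 2 * s <= n ->
  r ^ 3 * n ^ 9 * s ^ (2 * (s %/ 8)) <= n ^ (2 * (s %/ 8)).
Proof.
move=> hr; have [h0 H] := poly_leq_exp2 (r ^ 3 * 256 ^ 9) 18.
exists (256 * h0 ^ 2 + r ^ 3) => n s hn hs sn.
have r3 : 0 < r ^ 3 by rewrite expn_gt0; lia.
have nr3 : r ^ 3 <= n by lia.
have [s16 h10 s8 n0] : [/\ s <= 16 * (s %/ 8), 10 <= s %/ 8,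
    8 * (s %/ 8) <= s & 0 < n] by split; lia.
set h := s %/ 8 in s16 h10 s8 *.
have [ss|ss] := leqP (s ^ 2) n.
  apply: (@leq_trans (n ^ h * n ^ h)); last by rewrite -expnD addnn mul2n.
  rewrite expnM leq_mul ?leq_expl //.
  apply: (@leq_trans (n ^ 10)); first by rewrite (expnS n 9) leq_mul2r nr3 orbT.
  by rewrite leq_pexp2l.
have nh : n <= 256 * h ^ 2.
  apply: leq_trans (ltnW ss) _.
  by apply: leq_trans (leq_expl 2 s16) _; rewrite expnMn.
have hh : h0 <= h.
  rewrite -(@leq_exp2r h0 h 2) // -(leq_pmul2l (_ : 0 < 256)) //.
  by apply: leq_trans nh; apply: leq_trans hn; rewrite leq_addr.
apply: (@leq_trans (2 ^ (2 * h) * s ^ (2 * h))); last by rewrite -expnMn leq_expl.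
rewrite leq_mul2r; apply/orP; right.
apply: (@leq_trans (2 ^ h)); last by rewrite leq_exp2l // leq_pmull.
apply: leq_trans (H h hh); rewrite -mulnA leq_mul2l; apply/orP; right.
by apply: leq_trans (leq_expl 9 nh) _; rewrite expnMn -expnM.
Qed.

Lemma card_cover (T I : finType) (J : pred I) (A : {set T}) (B : I -> {set T}) :
  (forall x, x \in A -> exists2 i, J i & x \in B i) ->
  #|A| <= \sum_(i | J i) #|B i|.
Proof.
move=> h; rewrite -sum1_card.
apply: (@leq_trans (\sum_(x in A) \sum_(i | J i) (x \in B i : nat))).
  apply: leq_sum => x /h[i Ji xB].
  by rewrite (bigD1 i) //= xB.
rewrite exchange_big; apply: leq_sum => i _.
by rewrite -big_mkcondr -sum1_card big_mkcond [leqRHS]big_mkcond;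
   apply: leq_sum => x _; case: (x \in A) => //=; case: (x \in B i).
Qed.

(** The first bound is 2-edge-connectivity, the second linear edge expansion; sets up to half
    suffice since complements have equal cuts. *)
Definition expander (V : finType) (D : nat) (E : {set {set V}}) : bool :=
  [forall S : {set V}, (0 < #|S|) && (2 * #|S| <= #|V|) ==>
     (2 <= cut E S) && (#|S| <= D * cut E S)].

Section BadGraphs.
Variables (V : finType) (r : nat).
Hypothesis hr : 3 <= r.
Let n := #|V|.
Let R := #|regular V r|.

Let with_cut (s k : nat) : {set {set {set V}}} :=
  [set E in regular V r | [exists S : {set V}, (#|S| == s) && (cut E S == k)]]%SET.

Let card_with_cut (s k m B : nat) : s <= n ->
  (forall S : {set V}, #|S| = s -> 'C(n, s) * #|cut_class r S k| * m <= B) ->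
  #|with_cut s k| * m <= B.
Proof.
move=> sn hS.
have h : #|with_cut s k| <= \sum_(S : {set V} | #|S| == s) #|cut_class r S k|.
  apply: card_cover => E; rewrite inE => /andP[ER /existsP[S /andP[Ss ck]]].
  by exists S => //; rewrite inE ER ck.
have C0 : 0 < 'C(n, s) by rewrite bin_gt0.
rewrite -(leq_pmul2l C0).
apply: (@leq_trans (\sum_(S : {set V} | #|S| == s) B)).
  apply: (@leq_trans ('C(n, s) * ((\sum_(S : {set V} | #|S| == s) #|cut_class r S k|) * m))).
    by rewrite leq_mul2l leq_mul2r h !orbT.
  rewrite big_distrl big_distrr /=; apply: leq_sum => S /eqP Ss.
  by rewrite mulnA hS.
by rewrite sum_nat_const -(card_draws V s) /n cardsE.
Qed.

Let N_le (S : {set V}) k : #|cut_class r S k| <= R.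
Proof. by apply/subset_leq_card/fintype.subsetP => E; rewrite inE => /andP[]. Qed.

Let step (S : {set V}) k : #|cut_class r S k| *
    ((r * #|S| - k) * (r * (n - #|S|) - k) - 2 * k * r ^ 2) <=
  #|cut_class r S k.+2| * (k.+2 * k.+1).
Proof.
have -> : n - #|S| = #|(~: S)%SET| by rewrite /n -(cardsC S) addKn.
exact: switch_count.
Qed.

Let bin_le_exp m k : 'C(m, k) <= m ^ k.
Proof.
apply: leq_trans (ffact_leq_exp m k); rewrite -bin_ffact leq_pmulr //.
exact: fact_gt0.
Qed.

(** [s1] is both a size threshold and the expansion constant. A failing set has either size below
    [s1] and cut at most 1, which has probability O(1 / n), or size s >= [s1] and cut at most s /
    (256 r), which has probability at most n^-3 for each size and cut. *)
Lemma card_expander_compl (n0 : nat) :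
  (forall s, n0 <= n -> 512 * r ^ 3 <= s -> 2 * s <= n ->
     r ^ 3 * n ^ 9 * s ^ (2 * (s %/ 8)) <= n ^ (2 * (s %/ 8))) ->
  let s1 := 512 * r ^ 3 in
  n0 + 4 * (r * s1) * r ^ 2 <= n ->
  n * #|[set E in regular V r | ~~ expander s1 E]%SET| <=
  (2 * s1 * ((r * s1).+2 ^ 2) ^ s1 + 4) * R.
Proof.
move=> numeric s1 hn; set bad := finset _.
have r1 : 0 < r ^ 2 by rewrite expn_gt0; lia.
have r_s1 : 256 * r <= s1.
  by rewrite /s1 expnS mulnCA mulnC leq_mul2l; apply/orP; right; lia.
have r0 : 0 < r by lia.
have s1_gt0 : 0 < s1 by rewrite /s1 muln_gt0 expn_gt0 r0.
have hs1 : 512 * r ^ 3 <= s1 by [].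
have hs1' s : s1 <= s -> 512 * r ^ 3 <= s by [].
have nn0 : n0 <= n by apply: leq_trans hn; rewrite leq_addr.
have s1n : r * s1 <= n.
  apply: leq_trans hn; apply: leq_trans (leq_addl _ _).
  by rewrite -mulnA mulnCA leq_pmulr // muln_gt0.
have s1n' : s1 <= n by apply: leq_trans s1n; rewrite leq_pmull.
have n_gt0 : 0 < n by apply: leq_trans s1n'.
clearbody s1.
have small s k : 2 <= s -> s < s1 -> k <= 1 ->
    #|with_cut s k| * n <= ((r * s1).+2 ^ 2) ^ s1 * R.
  move=> s2 ss1 k1; apply: card_with_cut; first exact: ltnW (leq_trans ss1 s1n').
  move=> S Ss.
  have stepS := step S; rewrite Ss in stepS.
  (* The s + 1 steps give one factor [n] more than the n^s choices of [S] consume; they fit because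
     r >= 3, s >= 2 and k <= 1. *)
  have := small_chain (N_le S) stepS (n := n) (k := k) (j := s.+1).
  have rs : 3 * s <= r * s by rewrite leq_mul2r hr orbT.
  have rs1 : r * s <= r * s1 by rewrite leq_mul2l ltnW ?orbT.
  have rn : r * (n - s) = r * n - r * s by rewrite mulnBr.
  have rn3 : 3 * n <= r * n by rewrite leq_mul2r hr orbT.
  have h1 : r * s * r ^ 2 <= r * s1 * r ^ 2 by rewrite leq_mul2r rs1 orbT.
  have h2 : r * s1 <= r * s1 * r ^ 2 by rewrite leq_pmulr.
  have h3 : 4 * (r * s1 * r ^ 2) <= n by apply: leq_trans hn; rewrite mulnA leq_addl.
  have h4 : n + r * s + 2 * (r * s) * r ^ 2 <= r * (n - s).
    rewrite rn -(mulnA 2); move: (r * s * r ^ 2) (r * s1 * r ^ 2) h1 h2 h3.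
    move: (r * s) (r * s1) (r * n) rs rs1 rn3 s1n; clear; lia.
  have h5 : k + 2 * s.+1 <= (r * s).+1 by move: (r * s) rs s2 k1; clear; lia.
  move=> /(_ h4 h5) {h1 h2 h3 h4 h5} h3.
  apply: (@leq_trans (n ^ s.+1 * #|cut_class r S k|)).
    by rewrite expnS mulnAC leq_mul2r mulnC leq_mul2l bin_le_exp !orbT.
  apply: leq_trans h3 _; rewrite leq_mul2r; apply/orP; right.
  apply: (@leq_trans (((r * s1).+2 ^ 2) ^ s.+1)).
    by do 2!apply: leq_expl.
  by rewrite leq_pexp2l.
have large s k : s1 <= s -> 2 * s <= n -> 256 * r * k <= s ->
    #|with_cut s k| * n ^ 3 <= R.
  move=> ss1 sn hk; apply: card_with_cut.
    by apply: leq_trans sn; rewrite leq_pmull.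
  move=> S Ss.
  have stepS := step S; rewrite Ss in stepS.
  have h1 := large_bound hr (N_le S) stepS (hs1' _ ss1) sn hk.
  have h2 := numeric s nn0 (hs1' _ ss1) sn.
  rewrite -(@leq_exp2r _ _ 2) //.
  have p0 : 0 < n ^ (2 * (s %/ 8)) by rewrite expn_gt0 n_gt0.
  rewrite -(leq_pmul2r p0).
  move: h1 h2; set X := 'C(n, s) * _; set Y := n ^ (2 * _); set Z := s ^ (2 * _).
  move=> h1 h2; rewrite expnMn mulnAC -expnM.
  apply: leq_trans (leq_mul h1 (leqnn _)) _.
  apply: (@leq_trans (R ^ 2 * (r ^ 3 * n ^ 9 * Z))); last by rewrite leq_mul2l h2 orbT.
  rewrite (expnD n 3 6).
  by move: (R ^ 2) (r ^ 3) (n ^ 3) (n ^ 6) => *; clear; lia.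
pose I := ('I_s1 * 'I_2 + 'I_n.+1 * 'I_n.+1)%type.
pose J (i : I) := match i with
  | inl p => 2 <= p.1
  | inr p => [&& s1 <= p.1, 2 * p.1 <= n & 256 * r * p.2 <= p.1] end.
pose B (i : I) := match i with
  | inl p => with_cut p.1 p.2 | inr p => with_cut p.1 p.2 end.
have cover : #|bad| <= \sum_(i | J i) #|B i|.
  apply: card_cover => E; rewrite inE => /andP[ER].
  move=> /forallPn[S]; rewrite negb_imply -/n => /andP[/andP[S0 Sn] nS].
  have inW : E \in with_cut #|S| (cut E S).
    by rewrite inE ER; apply/existsP; exists S; rewrite !eqxx.
  have [ss1|ss1] := ltnP #|S| s1.
    have k1 : cut E S < 2.
      rewrite ltnNge; apply: contra nS => k2; rewrite k2 /=.
      by apply: leq_trans (ltnW ss1) _; rewrite leq_pmulr // ltnW.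
    exists (inl (Ordinal ss1, Ordinal k1)) => //=.
    (* A singleton has cut [r], hence more than 1. *)
    rewrite ltn_neqAle S0 andbT eq_sym; apply: contraTneq k1 => /eqP/cards1P[v Sv].
    have [sE dE] := regularP _ _ ER.
    rewrite -leqNgt /cut Sv big_set1.
    have := dE v; rewrite (bigD1 v) //=.
    have -> : adj E v v = false by apply: contraTF isT => /(adj_neq sE); rewrite eqxx.
    rewrite add0n => dv; apply: (@leq_trans r); first exact: ltnW.
    by rewrite -dv leq_eqVlt; apply/orP; left; apply/eqP/eq_bigl => z; rewrite !inE.
  have k1 : 256 * r * cut E S <= #|S|.
    rewrite leqNgt; apply: contra nS => k1.
    have h1 : #|S| <= s1 * cut E S.
      by apply: leq_trans (ltnW k1) _; rewrite leq_mul2r r_s1 orbT.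
    rewrite h1 andbT ltnNge; apply: contraTN k1 => k1; rewrite -leqNgt.
    apply: leq_trans ss1; apply: leq_trans r_s1.
    by rewrite -[leqRHS]muln1 leq_mul2l k1 orbT.
  have hs : #|S| < n.+1 by rewrite ltnS max_card.
  have hk : cut E S < n.+1.
    rewrite ltnS; apply: leq_trans (leq_trans k1 (max_card _)).
    by rewrite leq_pmull // muln_gt0.
  by exists (inr (Ordinal hs, Ordinal hk)); rewrite //= ss1 Sn k1.
rewrite mulnDl mulnC.
apply: leq_trans (leq_mul cover (leqnn n)) _.
rewrite big_sumType mulnDl /=; apply: leq_add.
  rewrite big_distrl /=.
  apply: (@leq_trans (\sum_(p : 'I_s1 * 'I_2 | 2 <= p.1) ((r * s1).+2 ^ 2) ^ s1 * R)).
    by apply: leq_sum => -[s k] /= s2; apply: small => //; rewrite -ltnS.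
  rewrite sum_nat_const mulnA !leq_mul2r; apply/orP; right; apply/orP; right.
  by apply: leq_trans (max_card _) _; rewrite card_prod !card_ord mulnC.
have n2 : 0 < n ^ 2 by rewrite expn_gt0 n_gt0.
rewrite -(leq_pmul2r n2) -mulnA -[n * n ^ 2]expnS big_distrl /=.
apply: (@leq_trans (\sum_(p : 'I_n.+1 * 'I_n.+1 | [&& s1 <= p.1, 2 * p.1 <= n &
    256 * r * p.2 <= p.1]) R)).
  by apply: leq_sum => -[s k] /= /and3P[]; apply: large.
rewrite sum_nat_const mulnAC leq_mul2r; apply/orP; right.
(* There are at most (n + 1)^2 <= 4 n^2 pairs, whence the constant 4. *)
apply: leq_trans (max_card _) _; rewrite card_prod !card_ord.
rewrite mulnC [leqRHS]mulnC (_ : 4 = 2 * 2) // expnS expn1 mulnACA.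
by apply: leq_mul; rewrite mul2n -addnn -addn1 leq_add2l.
Qed.

End BadGraphs.

(** * Rainbow connectivity of 2-edge-connected graphs of given radius *)

(** The graph joining each x to f x is 2-degenerate: in any finite set the average number of
    preimages is at most one, so some y has at most one. Once the rest is coloured, only the colours
    of f y and of that preimage are forbidden for y. *)
Lemma functional_coloring (T : finType) (f : T -> T) :
  exists chi : T -> 'I_3, forall x, f x != x -> chi x != chi (f x).
Proof.
suff /(_ _ [set: T]%SET erefl) [chi H] : forall m (A : {set T}), #|A| = m ->
    exists chi : T -> 'I_3,
      forall x, x \in A -> f x \in A -> f x != x -> chi x != chi (f x).
  by exists chi => x; apply: H; rewrite inE.
elim=> [|m IHm] A cA.
  by exists (fun=> ord0) => x; rewrite (cards0_eq cA) inE.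
have [y yA hy] : exists2 y, y \in A & #|[set x in A | f x == y]%SET| <= 1.
  apply: contrapT => nex.
  have : \sum_(y in A) 2 <= \sum_(y in A) #|[set x in A | f x == y]%SET|.
    apply: leq_sum => y yA; rewrite leqNgt; apply/negP => hy.
    by apply: nex; exists y.
  rewrite sum_nat_const leqNgt => /negP; apply.
  apply: (@leq_ltn_trans #|A|); last by rewrite cA; lia.
  under eq_bigr do rewrite -sum1dep_card big_mkcondr /=.
  rewrite exchange_big /= -sum1_card; apply: leq_sum => x xA.
  rewrite -big_mkcondr sum1_card; apply: leq_trans (_ : #|pred1 (f x)| <= 1).
    apply: subset_leq_card; apply/fintype.subsetP => z.
    by rewrite !inE => /andP[_ /eqP ->].
  by rewrite card1.
have cAy : #|(A :\ y)%SET| = m by have := cardsD1 y A; rewrite yA cA add1n => -[].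
have [chi H] := IHm _ cAy.
have [x0 hx0] : exists x0, forall x, x \in A -> f x = y -> x = x0.
  have [h0|[x0 hx0]] := set_0Vmem [set x in A | f x == y]%SET.
    exists y => x xA fx; have : x \in [set x in A | f x == y]%SET by rewrite inE xA fx eqxx.
    by rewrite h0 inE.
  exists x0 => x xA fx; move: hy => /card_le1_eqP; apply=> //.
  by rewrite inE xA fx eqxx.
have [c cP] : exists c : 'I_3, (c != chi (f y)) && (c != chi x0).
  apply: contrapT => nex.
  have : [set: 'I_3]%SET \subset [set chi (f y); chi x0]%SET.
    apply/fintype.subsetP => c _.
    have : ~~ ((c != chi (f y)) && (c != chi x0)) by apply/negP => h; apply: nex; exists c.
    rewrite negb_and !negbK !inE.
    by case/orP => ->; rewrite ?orbT.
  move/subset_leq_card; rewrite cardsT card_ord cards2.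
  by case: (_ == _).
case/andP: cP => c1 c2.
exists (fun x => if x == y then c else chi x) => x xA fxA fxx.
have [xy|xy] := eqVneq x y.
  by rewrite -xy (negPf fxx) xy.
have [fxy|fxy] := eqVneq (f x) y; last by apply: H; rewrite ?inE ?xy ?fxy.
by rewrite (hx0 x xA fxy) eq_sym.
Qed.

Section Walks.
Variables (V : finType) (E : {set {set V}}).

(** Vertices may repeat, so walks can be concatenated and reversed freely while their colours are
    tracked; paths are extracted only at the end. *)
Definition colored_walk (c : {set V} -> nat) (A : {set V}) (x y : V)
    (s : seq nat) : Prop :=
  exists p, [/\ path (adj E) x p, last x p = y, {subset x :: p <= A}
    & map c (walk_edges x p) = s].

Lemma colored_walk_nil c (A : {set V}) x : x \in A -> colored_walk c A x x [::].
Proof. by move=> xA; exists [::]; split=> // z; rewrite inE => /eqP ->. Qed.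

Lemma colored_walk1 (c : {set V} -> nat) (A : {set V}) x y :
  x \in A -> y \in A -> adj E x y -> colored_walk c A x y [:: c [set x; y]%SET].
Proof.
move=> xA yA xy; exists [:: y]; split; rewrite //= ?xy // => z.
by rewrite !inE => /orP[] /eqP ->.
Qed.

Lemma colored_walk_cat c A x y z s t :
  colored_walk c A x y s -> colored_walk c A y z t ->
  colored_walk c A x z (s ++ t).
Proof.
case=> p [pp lp Ap <-] [q [pq lq Aq <-]]; exists (p ++ q); split.
- by rewrite cat_path pp lp.
- by rewrite last_cat lp.
- move=> v; rewrite -cat_cons mem_cat => /orP[/Ap //|vq].
  by apply: Aq; rewrite inE vq orbT.
- by rewrite /walk_edges pairmap_cat map_cat lp.
Qed.

Lemma colored_walk_rev c A x y s :
  colored_walk c A x y s -> colored_walk c A y x (rev s).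
Proof.
case=> p [pp lp Ap <-] {s}; elim: p x pp lp Ap => [|z p IHp] x /=.
  by move=> _ <- Ap; apply: colored_walk_nil; apply: Ap; rewrite mem_head.
case/andP => xz zp lp Ap; rewrite rev_cons -cats1.
apply: colored_walk_cat (IHp z zp lp _) _.
  by move=> v vp; apply: Ap; rewrite inE vp orbT.
rewrite finset.setUC; apply: colored_walk1; last by rewrite adjC.
  by apply: Ap; rewrite !inE eqxx orbT.
by apply: Ap; rewrite mem_head.
Qed.

Lemma colored_walk_sub c c' (A B : {set V}) x y s :
  (forall e : {set V}, e \subset A -> c' e = c e) -> A \subset B ->
  colored_walk c A x y s -> colored_walk c' B x y s.
Proof.
move=> cc /fintype.subsetP AB [p [pp lp Ap <-]]; exists p; split => //.
  by move=> v /Ap /AB.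
apply/eq_in_map => e /walk_edges_sub he; apply: cc.
by apply/fintype.subsetP => v /he /Ap.
Qed.

(** The walk is shortened to a path using only its own edges, on which [c] is injective because the
    colour sequence has no repetition. *)
Lemma colored_walk_simple c A x y s : colored_walk c A x y s -> uniq s ->
  exists p, [/\ path (adj E) x p, last x p = y, uniq (x :: p)
    & uniq (map c (walk_edges x p))].
Proof.
case=> p [pp lp _ <-] us.
pose e u v := adj E u v && ([set u; v]%SET \in walk_edges x p).
have ep : path e x p.
  have : {subset walk_edges x p <= walk_edges x p} by [].
  rewrite {}/e; move: {2 3}(walk_edges x p) => L.
  elim: p x pp {lp us} => [|z q IHq] x //= /andP[xz zq] hL.
  rewrite xz hL ?mem_head //=; apply: IHq zq _ => f fq.
  by apply: hL; rewrite inE fq orbT.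
move: lp; case/shortenP: ep => q eq uq _ lq.
exists q; split=> //; first by apply: sub_path eq => u v /andP[].
rewrite map_inj_in_uniq ?uniq_walk_edges // => f g fq gq.
have sub h : h \in walk_edges x q -> h \in walk_edges x p.
  have : path (adj (finset.finset (mem (walk_edges x p)))) x q.
    by apply: sub_path eq => u v /andP[_]; rewrite /adj inE.
  by move/walk_edges_in => H /H; rewrite inE.
move/sub: fq => fq; move/sub: gq => gq fg.
rewrite -(nth_index f fq) -(nth_index f gq); congr nth; apply/eqP.
rewrite -(nth_uniq 0 _ _ us) ?size_map ?index_mem //.
by rewrite !(nth_map f) ?index_mem // !nth_index // fg.
Qed.

End Walks.

(** Invariant of the growth: only edges inside [D] are constrained, so the others can be recoloured
    in each round. *)
Definition walk_dominating (V : finType) (E : {set {set V}}) (c : {set V} -> nat)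
    (D : {set V}) (k : nat) : Prop :=
  (forall e : {set V}, e \in E -> e \subset D -> c e < k) /\
  forall x y, x \in D -> y \in D ->
    exists2 s, colored_walk E c D x y s & uniq s.

(** k + 3 i + a encodes the pair of a level i and a branch colour a, above the first k colours. *)
Lemma level_color_inj (k i j : nat) (a b : 'I_3) :
  k + 3 * i + a = k + 3 * j + b -> i = j /\ a = b.
Proof.
have := ltn_ord a; have := ltn_ord b => b3 a3 e.
have ab : a = b :> nat by lia.
by split; [lia|exact: val_inj].
Qed.

Lemma level_color_lt (k j m : nat) (a : 'I_3) : j < m ->
  k + 3 * j + a < k + 3 * m.
Proof. by have := ltn_ord a; lia. Qed.

Lemma level_color_ge (k j : nat) (a : 'I_3) : k <= k + 3 * j + a.
Proof. by rewrite -addnA leq_addr. Qed.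

Section Growth.
Variables (V : finType) (E : {set {set V}}) (c : {set V} -> nat).
Variables (D : {set V}) (k rho : nat) (lv : V -> nat) (par : V -> V).
Hypotheses (lv0 : forall v, (lv v == 0) = (v \in D)).
Hypotheses (parE : forall v, v \notin D -> adj E v (par v)).
Hypotheses (lv_par : forall v, v \notin D -> lv v = (lv (par v)).+1).
Hypotheses (par_id : forall v, v \in D -> par v = v).
Hypotheses (lv_rho : forall v, lv v <= rho).
Hypotheses (cut2 : forall S : {set V}, S != finset.set0 -> S != [set: V]%SET ->
  2 <= cut E S).
Hypotheses (D0 : D != finset.set0).
Hypothesis dom : walk_dominating E c D k.

(** The ancestor at level 1, which is the root of the branch of [v]; for [v] in [D] it is [v]
    itself. *)
Let top v := iter (lv v).-1 par v.

Let lvN v : v \notin D -> 0 < lv v.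
Proof. by rewrite -lv0 lt0n. Qed.

Let iterD m v : v \in D -> iter m par v = v.
Proof. by move=> vD; elim: m => //= m ->; rewrite par_id. Qed.

Let lv_iter m v : lv (iter m par v) = lv v - m.
Proof.
elim: m => [|m IHm] /=; first by rewrite subn0.
have [iD|iD] := boolP (iter m par v \in D).
  by move: (iD); rewrite par_id // -lv0 => /eqP lv_0; rewrite -lv0 in iD; lia.
by have := lv_par iD; lia.
Qed.

Let top_par v : v \notin D -> par v \notin D -> top (par v) = top v.
Proof.
move=> vD pD; rewrite /top (lv_par vD) /= -iterSr.
by have := lvN pD; case: (lv (par v)).
Qed.

Let top1 v : lv v = 1 -> top v = v.
Proof. by rewrite /top => ->. Qed.

Let branch x := [set v | (v \notin D) && (top v == x)]%SET.

(** The edge from the root [x] to its parent leaves the branch, and a cut of size at least two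
    provides another. Off level 1 the pair is arbitrary. *)
Let escape_ex (x : V) : exists w : V * V, lv x = 1 ->
  [/\ w.1 \in branch x, w.2 \notin branch x, adj E w.1 w.2 & w != (x, par x)].
Proof.
have [lx|lx] := eqVneq (lv x) 1; last by exists (x, x) => h; rewrite h in lx.
apply: contrapT => nex.
have xD : x \notin D by rewrite -lv0 lx.
have : 2 <= cut E (branch x).
  apply: cut2.
    by apply/set0Pn; exists x; rewrite inE xD top1 ?eqxx.
  case/set0Pn: D0 => d dD; apply/eqP => /setP /(_ d).
  by rewrite !inE dD.
rewrite leqNgt => /negP; apply; rewrite ltnS.
apply: (@leq_trans (\sum_(u in branch x) \sum_(v in (~: branch x)%SET)
    ((u == x) * (v == par x)))).
  apply: leq_sum => u ux; apply: leq_sum => v; rewrite finset.in_setC => vx.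
  case uv : (adj E u v) => //; have [e|ne] := eqVneq (u, v) (x, par x).
    by case: e => -> ->; rewrite !eqxx.
  by case: nex; exists (u, v).
under eq_bigr do rewrite -big_distrr /= sum_eq1.
by rewrite -big_distrl /= sum_eq1 mulnb leq_b1.
Qed.

Let esc := projT1 (choice escape_ex).
Let escP x : lv x = 1 ->
  [/\ (esc x).1 \in branch x, (esc x).2 \notin branch x,
      adj E (esc x).1 (esc x).2 & esc x != (x, par x)].
Proof. exact: (projT2 (choice escape_ex)). Qed.

Let chi := projT1 (cid (functional_coloring (fun x => top (esc x).2))).
Let chiP x : top (esc x).2 != x -> chi x != chi (top (esc x).2).
Proof.
exact: (projT2 (cid (functional_coloring (fun x => top (esc x).2)))).
Qed.

(** One shared colour suffices for the new edges outside the forest, as a joining walk uses at most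
    one of them. *)
Let c' (e : {set V}) : nat :=
  if e \subset D then c e else
  if [pick v | (v \notin D) && (e == [set v; par v]%SET)] is Some v
  then k + 3 * (lv v).-1 + chi (top v) else k + 3 * rho.

Let c'_tree v : v \notin D ->
  c' [set v; par v]%SET = k + 3 * (lv v).-1 + chi (top v).
Proof.
move=> vD; rewrite /c'; case: ifP => [/fintype.subsetP/(_ v)|_].
  by rewrite set21 (negPf vD) => /(_ isT).
case: pickP => [w /andP[wD /eqP/setP e]|/(_ v)]; last by rewrite vD eqxx.
have := e v; rewrite !inE eqxx /= => /esym/orP[/eqP -> //|/eqP vw].
have := e w; rewrite !inE eqxx /= => /orP[/eqP -> //|/eqP wv].
by have := lv_par vD; have := lv_par wD; rewrite -vw -wv; lia.
Qed.

Let c'_lt e : e \in E -> c' e < k + 3 * rho + 1.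
Proof.
move=> eE; rewrite addn1 ltnS /c'; case: ifP => [eD|_].
  exact: leq_trans (ltnW (dom.1 e eE eD)) (leq_addr _ _).
case: pickP => [v /andP[vD _]|//]; apply/ltnW/level_color_lt.
by apply: leq_trans (lv_rho v); rewrite prednK ?lvN.
Qed.

(** A forest edge stays inside a branch unless it joins the root to [D], and the choice of [esc x]
    excludes that edge. *)
Let c'_esc x : lv x = 1 -> c' [set (esc x).1; (esc x).2]%SET = k + 3 * rho.
Proof.
move=> lx; have [w1 w2 w12 wx] := escP lx.
move: w1 w2; rewrite !inE => /andP[w1D /eqP tw1]; rewrite negb_and negbK => w2.
rewrite /c'; case: ifP => [/fintype.subsetP/(_ (esc x).1)|_].
  by rewrite set21 (negPf w1D) => /(_ isT).
case: pickP => // v /andP[vD /eqP/setP e]; exfalso.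
have := e v; rewrite !inE eqxx /= => /orP[]/eqP vw.
  have wp : (esc x).2 = par v.
    have := e (par v); rewrite !inE eqxx orbT => /orP[]/eqP // h.
    by have := lv_par vD; rewrite h -vw; lia.
  have [pD|pD] := boolP (par v \in D).
    have lv1 : lv v = 1 by rewrite lv_par //; move: pD; rewrite -lv0 => /eqP ->.
    have vx : v = x by rewrite -(top1 lv1) vw.
    by move: wx; rewrite (surjective_pairing (esc x)) -vw wp vx eqxx.
  by move: w2; rewrite wp (negPf pD) /= top_par // vw tw1 eqxx.
have wp : (esc x).1 = par v.
  have := e (par v); rewrite !inE eqxx orbT => /orP[]/eqP // h.
  by have := lv_par vD; rewrite h -vw; lia.
move: w2; rewrite -vw (negPf vD) /= -top_par -?wp // tw1 eqxx.
by [].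
Qed.

(** These vertices lie on the forest paths to [D] from the two ends of an escape edge, which form an
    ear of [D]. *)
Let anchored (v : V) : bool := [exists x, (lv x == 1) &&
  (fconnect par (esc x).1 v || fconnect par (esc x).2 v)].

Let D' := (D :|: [set v | anchored v])%SET.

Let subD : D \subset D'. Proof. exact: finset.subsetUl. Qed.

Let parD' v : v \in D' -> par v \in D'.
Proof.
rewrite !inE => /orP[vD|/existsP[x /andP[lx h]]]; first by rewrite par_id ?vD.
apply/orP; right; apply/existsP; exists x; rewrite lx /=.
by case/orP: h => h; rewrite (connect_trans h (fconnect1 _ _)) ?orbT.
Qed.

Let iterD' m v : v \in D' -> iter m par v \in D'.
Proof. by move=> vD; elim: m => //= m; exact: parD'. Qed.

Let escD' x : lv x = 1 -> (esc x).1 \in D' /\ (esc x).2 \in D'.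
Proof.
by move=> lx; split; rewrite !inE; apply/orP; right; apply/existsP; exists x;
   rewrite lx eqxx connect0 ?orbT.
Qed.

Let up_walk v : v \in D' -> exists d s, [/\ d \in D, colored_walk E c' D' v d s,
  uniq s & forall t, t \in s -> exists2 j, j < lv v & t = k + 3 * j + chi (top v)].
Proof.
move: {2}(lv v) (erefl (lv v)) => m; elim: m v => [|m IHm] v lm vD'.
  by exists v, [::]; split=> //; [rewrite -lv0 lm|exact: colored_walk_nil].
have vD : v \notin D by rewrite -lv0 lm.
have lp : lv (par v) = m by have := lv_par vD; lia.
have [d [s [dD ws us hs]]] := IHm _ lp (parD' vD').
have hs' t : t \in s -> exists2 j, j < m & t = k + 3 * j + chi (top v).
  move=> ts; have [j jm ->] := hs t ts; rewrite lp in jm; exists j => //.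
  rewrite top_par // -lv0 lp; lia.
exists d, (k + 3 * m + chi (top v) :: s); split=> //.
- rewrite -cat1s; apply: colored_walk_cat ws.
  have <- : c' [set v; par v]%SET = k + 3 * m + chi (top v).
    by rewrite c'_tree // lm.
  by apply: colored_walk1 => //; [exact: parD'|exact: parE].
- by rewrite /= us andbT; apply/negP => /hs' [j jm]; lia.
move=> t; rewrite inE => /orP[/eqP ->|/hs' [j jm ->]].
  by exists m; rewrite ?lm.
by exists j => //; rewrite lm ltnW.
Qed.

(** Used in reverse, as a descent from an ancestor to [z]. Its level indices are at least the level
    of the ancestor, those of the ascent from the ancestor are below it. *)
Let down_walk m z : z \in D' -> iter m par z \notin D -> exists s,
  [/\ colored_walk E c' D' z (iter m par z) s, uniq s &
   forall t, t \in s -> exists2 j, lv z - m <= j < lv z & t = k + 3 * j + chi (top z)].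
Proof.
move=> zD'; elim: m => [|m IHm] /= iD.
  by exists [::]; split=> //; exact: colored_walk_nil.
have pD : iter m par z \notin D.
  by apply: contraNN iD => h; rewrite par_id.
have [s [ws us hs]] := IHm pD.
have tz : top (iter m par z) = top z.
  elim: (m) pD => //= i IHi hi.
  have hi' : iter i par z \notin D by apply: contraNN hi => h; rewrite par_id.
  by rewrite top_par // IHi.
exists (s ++ [:: k + 3 * (lv z - m).-1 + chi (top z)]).
have lm := lvN pD; rewrite lv_iter in lm.
split.
- apply: colored_walk_cat ws _.
  rewrite -tz -lv_iter -c'_tree //.
  by apply: colored_walk1; [exact: iterD'|apply/parD'/iterD'|exact: parE].
- rewrite cats1 rcons_uniq us andbT; apply/negP => /hs [j hj]; lia.
move=> t; rewrite mem_cat inE => /orP[/hs[j hj ->]|/eqP ->].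
  by exists j => //; lia.
by exists (lv z - m).-1 => //; lia.
Qed.

(** Either [v] is an ancestor of the inner end of the escape edge of its own branch, or of the outer
    end of one from another branch. In both cases [chiP] gives the far end another colour unless it
    is in [D]. *)
Let anchor v : v \in D' -> v \notin D -> exists m z z',
  [/\ v = iter m par z, z \in D', z' \in D', adj E z z' &
   c' [set z; z']%SET = k + 3 * rho /\ (z' \in D \/ chi (top z') != chi (top v))].
Proof.
move=> vD' vD; move: (vD'); rewrite !inE (negPf vD) => /existsP[x /andP[/eqP lx]].
have [w1 w2 w12 _] := escP lx; have [w1D' w2D'] := escD' lx.
move: w1 w2; rewrite !inE => /andP[w1D /eqP tw1]; rewrite negb_and negbK => w2.
have tv m z : v = iter m par z -> top v = top z.
  move=> e; move: vD; rewrite e; elim: (m) => //= i IHi hi.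
  have hi' : iter i par z \notin D by apply: contraNN hi => h; rewrite par_id.
  by rewrite top_par // IHi.
case/orP => /iter_findex e.
  exists (findex par (esc x).1 v), (esc x).1, (esc x).2; split => //.
  split; first exact: c'_esc.
  case/orP: w2 => w2; [by left|right].
  by rewrite (tv _ _ (esym e)) tw1 eq_sym; apply: chiP.
exists (findex par (esc x).2 v), (esc x).2, (esc x).1; split=> //.
  by rewrite adjC.
split; first by rewrite finset.setUC c'_esc.
right; rewrite (tv _ _ (esym e)) tw1; apply: chiP.
have w2D : (esc x).2 \notin D by apply: contraNN vD => h; rewrite -e iterD.
by rewrite (negPf w2D) /= in w2.
Qed.

(* A vertex at level i leaves D' either upwards, with the colours of its branch
   at levels at most i, or downwards, with those at levels above i followed by
   the colours of another branch. *)
Let out_walk v : v \in D' -> v \notin D -> exists d s,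
  [/\ d \in D, colored_walk E c' D' v d s, uniq s & forall t, t \in s ->
   [\/ exists2 j, lv v <= j < rho & t = k + 3 * j + chi (top v),
       t = k + 3 * rho |
       exists j (a : 'I_3), [/\ j < rho, a != chi (top v) & t = k + 3 * j + a]]].
Proof.
move=> vD' vD; have [m [z [z' [ev zD' z'D' zz' [cz hz']]]]] := anchor vD' vD.
have iD : iter m par z \notin D by rewrite -ev.
have [s [ws us hs]] := down_walk zD' iD.
rewrite -ev in ws.
have tz : top z = top v.
  rewrite ev; elim: (m) iD => //= i IHi hi.
  have hi' : iter i par z \notin D by apply: contraNN hi => h; rewrite par_id.
  by rewrite top_par // -IHi.
have lz : lv z - m = lv v by rewrite ev lv_iter.
have {}hs t : t \in s -> exists2 j, lv v <= j < rho & t = k + 3 * j + chi (top v).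
  move=> /hs[j]; rewrite lz tz => /andP[j1 j2] ->; exists j => //.
  by rewrite j1 (leq_trans j2).
have [d [s' [dD ws' us' hs']]] := up_walk z'D'.
have {}hs' t : t \in s' -> exists j (a : 'I_3),
    [/\ j < rho, a != chi (top v) & t = k + 3 * j + a].
  move=> /hs'[j jz ->]; exists j, (chi (top z')); split=> //.
    exact: leq_trans jz (lv_rho _).
  by case: hz' => // z'D; move: z'D jz; rewrite -lv0 => /eqP ->.
exists d, (rev s ++ k + 3 * rho :: s'); split=> //.
- apply: colored_walk_cat (colored_walk_rev ws) _.
  rewrite -cat1s -cz; apply: colored_walk_cat ws'; exact: colored_walk1.
- rewrite cat_uniq rev_uniq us /= us' andbT; apply/andP; split.
    rewrite mem_rev; apply/norP; split.
      apply/negP => /hs[j /andP[_ jr]] e.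
      by have := level_color_lt k (chi (top v)) jr; rewrite -e ltnn.
    apply/hasPn => t /hs'[j [a [ja av ->]]]; rewrite mem_rev.
    by apply/negP => /hs[i _ /level_color_inj[_ e]]; rewrite e eqxx in av.
  apply/negP => /hs'[j [a [ja _ e]]].
  by have := level_color_lt k a ja; rewrite -e ltnn.
move=> t; rewrite mem_cat mem_rev inE => /orP[/hs|/orP[/eqP|/hs']].
- by move=> ?; apply: Or31.
- by move=> ?; apply: Or32.
- by move=> ?; apply: Or33.
Qed.

(** The rainbow walk inside [D] has colours below [k], so it can link two walks with disjoint new
    colours. *)
Let join u v d d' s s' : d \in D -> d' \in D ->
  colored_walk E c' D' u d s -> colored_walk E c' D' v d' s' ->
  uniq s -> uniq s' -> (forall t, t \in s -> k <= t) ->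
  (forall t, t \in s' -> k <= t) -> (forall t, t \in s -> t \in s' -> False) ->
  exists2 t, colored_walk E c' D' u v t & uniq t.
Proof.
move=> dD d'D ws ws' us us' ks ks' disj.
have [t wt ut] := dom.2 d d' dD d'D.
have tk x : x \in t -> x < k.
  case: wt => p [pp _ hp <-] /mapP[e ep ->]; apply: dom.1.
    exact: walk_edges_in pp e ep.
  have he := walk_edges_sub ep.
  by apply/fintype.subsetP => y /he /hp.
have {}wt : colored_walk E c' D' d d' t.
  by apply: colored_walk_sub wt => // e eD; rewrite /c' eD.
exists (s ++ t ++ rev s').
  by apply: colored_walk_cat ws (colored_walk_cat wt (colored_walk_rev ws')).
rewrite !cat_uniq us ut rev_uniq us' /= andbT; apply/andP; split.
  apply/hasPn => x; rewrite mem_cat mem_rev => /orP[/tk xk|xs'].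
    by apply/negP => /ks; rewrite leqNgt xk.
  by apply/negP => xs; apply: disj xs xs'.
apply/hasPn => x; rewrite mem_rev => /ks' kx.
by apply/negP => /tk; rewrite ltnNge kx.
Qed.

(** [u] goes up on indices below [lv u]; [v] goes out on indices at least [lv v] in its own branch
    colour, then with the shared colour and another branch colour. *)
Let join_same u v : u \in D' -> v \in D' -> v \notin D -> lv u <= lv v ->
  chi (top u) = chi (top v) ->
  exists2 t, colored_walk E c' D' u v t & uniq t.
Proof.
move=> uD' vD' vD uv ab.
have [d [s [dD ws us hs]]] := up_walk uD'.
have [d' [s' [d'D ws' us' hs']]] := out_walk vD' vD.
have ur := leq_trans uv (lv_rho v).
apply: (join dD d'D ws ws') => //.
- by move=> t /hs[j _ ->]; exact: level_color_ge.
- move=> t /hs'[[j _ ->]|->|[j [a [_ _ ->]]]];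
    [exact: level_color_ge|exact: leq_addr|exact: level_color_ge].
move=> t /hs[i iu ->] /hs'[[j /andP[j1 _]]|e|[j [a [_ av]]]].
- by case/level_color_inj => ij _; move: j1; rewrite -ij leqNgt (leq_trans iu uv).
- have := level_color_lt k (chi (top u)) (leq_trans iu ur).
  by rewrite e ltnn.
by case/level_color_inj => _ e; rewrite -ab e eqxx in av.
Qed.

Let join_diff u v : u \in D' -> v \in D' ->
  [\/ u \in D, v \in D | chi (top u) != chi (top v)] ->
  exists2 t, colored_walk E c' D' u v t & uniq t.
Proof.
move=> uD' vD' uv.
have [d [s [dD ws us hs]]] := up_walk uD'.
have [d' [s' [d'D ws' us' hs']]] := up_walk vD'.
apply: (join dD d'D ws ws') => //.
- by move=> t /hs[j _ ->]; exact: level_color_ge.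
- by move=> t /hs'[j _ ->]; exact: level_color_ge.
move=> t /hs[i iu ->] /hs'[j jv] e.
case: uv => [|| ab]; try by rewrite -lv0 => /eqP l0; move: iu jv; rewrite l0.
by have [_ e'] := level_color_inj e; rewrite e' eqxx in ab.
Qed.

Lemma walk_dominating_grow : exists (c1 : {set V} -> nat) (D1 : {set V}),
  [/\ walk_dominating E c1 D1 (k + 3 * rho + 1), D \subset D1 &
      forall v, lv v = 1 -> v \in D1].
Proof.
exists c', D'; split=> //; last first.
  move=> v lv1; rewrite !inE; apply/orP; right; apply/existsP; exists v.
  rewrite lv1 eqxx /=; apply/orP; left.
  (* A vertex at level 1 is the root of its branch, hence an ancestor of the inner end of its escape
     edge. *)
  have [w1 _ _ _] := escP lv1; move: w1; rewrite inE => /andP[_ /eqP tv].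
  by have := fconnect_iter par (lv (esc v).1).-1 (esc v).1; rewrite -/(top _) tv.
split=> [e eE _|u v uD' vD']; first exact: c'_lt.
have [uD|uD] := boolP (u \in D); first by apply: join_diff => //; apply: Or31.
have [vD|vD] := boolP (v \in D); first by apply: join_diff => //; apply: Or32.
have [ab|ab] := eqVneq (chi (top u)) (chi (top v)); last first.
  by apply: join_diff => //; apply: Or33.
have [uv|uv] := leqP (lv u) (lv v); first exact: join_same.
have [t wt ut] := join_same vD' uD' uD (ltnW uv) (esym ab).
by exists (rev t); rewrite ?rev_uniq //; exact: colored_walk_rev.
Qed.

End Growth.

(** * Radius of expanders *)

Section Balls.
Variables (V : finType) (E : {set {set V}}).

Definition neighborhood (S : {set V}) : {set V} :=
  (S :|: [set v | [exists u in S, adj E u v]])%SET.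

Definition ball (i : nat) (S : {set V}) : {set V} := iter i neighborhood S.

Lemma in_neighborhood (S : {set V}) v :
  (v \in neighborhood S) = (v \in S) || [exists u in S, adj E u v].
Proof. by rewrite !inE. Qed.

Lemma sub_neighborhood (S : {set V}) : S \subset neighborhood S.
Proof. exact: finset.subsetUl. Qed.

Lemma mem_neighborhood (S : {set V}) u v :
  u \in S -> adj E u v -> v \in neighborhood S.
Proof.
by move=> uS uv; rewrite in_neighborhood; apply/orP; right; apply/exists_inP; exists u.
Qed.

Lemma neighborhoodS (S T : {set V}) :
  S \subset T -> neighborhood S \subset neighborhood T.
Proof.
move=> /fintype.subsetP ST; apply/fintype.subsetP => v.
rewrite in_neighborhood => /orP[/ST vT|].
  exact: (fintype.subsetP (sub_neighborhood T)).
by case/exists_inP => u /ST uT uv; apply: mem_neighborhood uv.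
Qed.

Lemma ballS i (S T : {set V}) : S \subset T -> ball i S \subset ball i T.
Proof. by move=> ST; elim: i => //= i; exact: neighborhoodS. Qed.

Lemma ball_cat i j u v w : w \in ball i [set u]%SET -> v \in ball j [set w]%SET ->
  v \in ball (i + j) [set u]%SET.
Proof.
move=> wu; rewrite addnC /ball iterD; apply/fintype.subsetP/ballS.
by rewrite finset.sub1set.
Qed.

Lemma ball_sym i u v : v \in ball i [set u]%SET -> u \in ball i [set v]%SET.
Proof.
elim: i v => [|i IHi] v; first by rewrite !inE eq_sym.
rewrite [ball i.+1 _]/(neighborhood _) in_neighborhood => /orP[/IHi|].
  exact/fintype.subsetP/sub_neighborhood.
case/exists_inP => w /IHi uw wv; rewrite -add1n.
apply: ball_cat uw; rewrite [ball 1 _]/(neighborhood _).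
apply: (@mem_neighborhood _ v); first by rewrite set11.
by rewrite adjC.
Qed.

Lemma levels_ex (D : {set V}) rho : (forall v, v \in ball rho D) ->
  exists (lv : V -> nat) (par : V -> V),
  [/\ forall v, (lv v == 0) = (v \in D),
      forall v, v \notin D -> adj E v (par v) /\ lv v = (lv (par v)).+1,
      forall v, v \in D -> par v = v,
      forall v, lv v <= rho &
      forall v i, v \in ball i D -> lv v <= i].
Proof.
move=> hD; have ex v : exists i, v \in ball i D by exists rho.
pose lv v := ex_minn (ex v).
have lvP v : v \in ball (lv v) D by rewrite /lv; case: ex_minnP.
have lv_min v i : v \in ball i D -> lv v <= i.
  by rewrite /lv; case: ex_minnP => m _; apply.
have lv0 v : (lv v == 0) = (v \in D).
  apply/eqP/idP => [e|vD]; first by have := lvP v; rewrite e.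
  by apply/eqP; rewrite -leqn0; apply: lv_min.
have hpar v : exists u, if v \in D then u = v else adj E v u /\ lv v = (lv u).+1.
  have [vD|vD] := boolP (v \in D); first by exists v.
  have := lvP v; case e: (lv v) => [|m].
    by move/eqP: e; rewrite lv0 (negPf vD).
  rewrite [ball m.+1 _]/(neighborhood _) in_neighborhood => /orP[/lv_min|].
    by rewrite e ltnn.
  case/exists_inP => u um uv; exists u; rewrite adjC; split=> //.
  apply/eqP; rewrite eqSS eqn_leq (lv_min _ _ um) andbT -ltnS -e.
  by apply: lv_min; apply: mem_neighborhood uv.
have [par parP] := choice hpar.
exists lv, par; split=> //.
- by move=> v vD; have := parP v; rewrite (negPf vD).
- by move=> v vD; have := parP v; rewrite vD.
- by move=> v; apply: lv_min.
Qed.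

Lemma radius_rainbow_colorable u rho : simple_graph E ->
  (forall S : {set V}, S != finset.set0 -> S != [set: V]%SET -> 2 <= cut E S) ->
  (forall v, v \in ball rho [set u]%SET) ->
  rainbow_colorable E (rho * (3 * rho + 1)).
Proof.
move=> sE cut2 hu.
have grow i : exists c (D : {set V}),
    walk_dominating E c D (i * (3 * rho + 1)) /\ ball i [set u]%SET \subset D.
  elim: i => [|i [c [D [dom iD]]]].
    exists (fun=> 0), [set u]%SET; split=> //; split=> [e eE /subset_leq_card|x y].
      by rewrite cards1; move/forall_inP: sE => /(_ e eE)/eqP ->.
    rewrite !inE => /eqP -> /eqP ->; exists [::] => //.
    by apply: colored_walk_nil; rewrite set11.
  have uD : [set u]%SET \subset D.
    apply: fintype.subset_trans iD; elim: (i) => // j IHj.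
    exact: fintype.subset_trans IHj (sub_neighborhood _).
  (* Since [D] contains [u], the same [rho] bounds the levels in every round. *)
  have hD v : v \in ball rho D by apply: (fintype.subsetP (ballS rho uD)).
  have [lv [par [lv0 hpar par_id lv_rho lv_min]]] := levels_ex hD.
  have D0 : D != finset.set0.
    by apply/set0Pn; exists u; apply: (fintype.subsetP uD); rewrite set11.
  have [c1 [D1 [dom1 DD1 lv1]]] := walk_dominating_grow lv0
    (fun v vD => (hpar v vD).1) (fun v vD => (hpar v vD).2) par_id lv_rho cut2 D0 dom.
  exists c1, D1; split; first by rewrite mulSnr addnA.
  apply: fintype.subset_trans (neighborhoodS iD) _.
  apply/fintype.subsetP => v vD.
  have [vD0|vD0] := boolP (v \in D); first exact: (fintype.subsetP DD1).
  apply: lv1; apply/eqP; rewrite eqn_leq (lv_min _ 1) //=.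
  by rewrite lt0n lv0.
have [c [D [dom hD]]] := grow rho.
have DT v : v \in D by apply: (fintype.subsetP hD).
exists c; split=> [e eE|x y]; first by apply: dom.1 => //; apply/fintype.subsetP.
have [s ws us] := dom.2 x y (DT x) (DT y).
exact: colored_walk_simple ws us.
Qed.

End Balls.

(** Bernoulli's inequality for (1 + 1 / q)^q. *)
Lemma pow_succ_ge (q : nat) : 0 < q -> 2 * q ^ q <= q.+1 ^ q.
Proof.
move=> q0; have H j : q ^ j * (q + j) <= q * q.+1 ^ j.
  elim: j => [|j IHj]; first by rewrite mul1n addn0 muln1.
  rewrite expnS [q.+1 ^ _]expnS [leqRHS]mulnCA.
  apply: leq_trans (leq_mul (leqnn q.+1) IHj).
  rewrite mulnAC mulnC [leqRHS]mulnCA leq_mul2l; apply/orP; right.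
  by move: q0; clear; nia.
rewrite -(leq_pmul2l q0) mulnCA (_ : 2 * (q * q ^ q) = q ^ q * (q + q)) ?H //.
by rewrite addnn -mul2n; move: (q ^ q); clear; lia.
Qed.

Section ExpanderRadius.
Variables (V : finType) (E : {set {set V}}) (r D : nat).
Hypotheses (hE : E \in regular V r) (exp : expander D E).

Lemma cutC (S : {set V}) : cut E (~: S)%SET = cut E S.
Proof.
rewrite /cut finset.setCK exchange_big; apply: eq_bigr => u _.
by apply: eq_bigr => v _; rewrite adjC.
Qed.

Lemma expander_cut2 (S : {set V}) :
  S != finset.set0 -> S != [set: V]%SET -> 2 <= cut E S.
Proof.
have key (T : {set V}) : T != finset.set0 -> 2 * #|T| <= #|V| -> 2 <= cut E T.
  by rewrite -card_gt0 => T0 Tn; have /forallP/(_ T) := exp; rewrite T0 Tn => /andP[].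
move=> S0 ST; have [Sn|Sn] := leqP (2 * #|S|) #|V|; first exact: key.
rewrite -cutC; apply: key; last by have := cardsC S; lia.
by apply: contraNneq ST => SC; rewrite -[S]finset.setCK SC finset.setC0.
Qed.

(** Each new vertex absorbs at most [r] crossing edges, so at least |S| / (r D) vertices are
    added. *)
Lemma neighborhood_growth (S : {set V}) : S != finset.set0 -> 2 * #|S| <= #|V| ->
  (r * D).+1 * #|S| <= r * D * #|neighborhood E S|.
Proof.
move=> S0 Sn; have [sE dE] := regularP _ _ hE.
have hS : #|S| <= D * cut E S.
  by have /forallP/(_ S) := exp; rewrite card_gt0 S0 Sn => /andP[].
have hc : cut E S <= r * #|(neighborhood E S :\: S)%SET|.
  rewrite mulnC -sum_nat_const /cut exchange_big.
  rewrite [leqRHS]big_mkcond [leqLHS]big_mkcond /=; apply: leq_sum => v _.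
  rewrite !inE; case: (boolP (v \in S)) => //= vS.
  case: (boolP [exists u in S, adj E u v]) => [_|nex].
    apply: (@leq_trans (\sum_u (adj E v u : nat))); last by rewrite dE.
    rewrite [leqRHS](bigID (mem S)) /=.
    by under eq_bigr do rewrite adjC; exact: leq_addr.
  rewrite big1 // => u uS; apply/eqP; rewrite eqb0.
  by apply: contra nex => uv; apply/exists_inP; exists u.
have -> : #|neighborhood E S| = #|S| + #|(neighborhood E S :\: S)%SET|.
  by rewrite -(cardsID S) (finset.setIidPr (sub_neighborhood E S)).
rewrite mulSn addnC mulnDr leq_add2l; apply: leq_trans hS _.
by rewrite mulnAC mulnC leq_mul2r hc orbT.
Qed.

Hypotheses (r0 : 0 < r) (D0 : 0 < D).

(** As long as a ball holds at most half of the vertices, it grows by a factor 1 + 1 / q per step,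
    hence at least doubles in q steps; one doubling more than [trunc_log] exceeds the number of
    vertices. *)
Lemma half_ball (u : V) :
  #|V| < 2 * #|ball E (r * D * (trunc_log 2 #|V|).+1) [set u]%SET|.
Proof.
set q := r * D; have q0 : 0 < q by rewrite muln_gt0 r0.
set m := q * _; rewrite ltnNge; apply/negP => hm.
have mono i : i <= m -> 2 * #|ball E i [set u]%SET| <= #|V|.
  move=> im; apply: leq_trans hm; rewrite leq_mul2l /=; apply: subset_leq_card.
  rewrite -(subnK im) /ball iterD; elim: (m - i) => //= j IHj.
  exact: fintype.subset_trans IHj (sub_neighborhood _ _).
have grow i : i <= m -> q.+1 ^ i <= q ^ i * #|ball E i [set u]%SET|.
  elim: i => [|i IHi] im; first by rewrite !mul1n /= cards1.
  have b0 : ball E i [set u]%SET != finset.set0.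
    by rewrite -card_gt0; have := IHi (ltnW im); case: #|_| => //;
       rewrite muln0 leqn0 expn_eq0.
  have := neighborhood_growth b0 (mono i (ltnW im)) => h.
  rewrite !expnS -mulnA mulnCA.
  apply: leq_trans (leq_mul (leqnn _) h); rewrite mulnCA leq_mul2l.
  by rewrite (IHi (ltnW im)) orbT.
have := grow m (leqnn m); rewrite leqNgt => /negP; apply.
have h1 : q ^ m * 2 ^ (trunc_log 2 #|V|).+1 <= q.+1 ^ m.
  rewrite /m (expnM q q) (expnM q.+1 q) -expnMn.
  apply: leq_expl; rewrite [_ * 2]mulnC; exact: pow_succ_ge.
apply: leq_trans h1; rewrite ltn_pmul2l ?expn_gt0 ?q0 //.
apply: leq_ltn_trans (trunc_log_ltn _ _) => //.
by apply: leq_trans (mono m (leqnn m)); rewrite leq_pmull.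
Qed.

(** Two balls that each hold more than half of the vertices meet. *)
Lemma expander_radius (u v : V) :
  v \in ball E (2 * (r * D * (trunc_log 2 #|V|).+1)) [set u]%SET.
Proof.
set m := r * D * _.
have [w] : exists w, w \in (ball E m [set u] :&: ball E m [set v])%SET.
  apply/set0Pn; rewrite -card_gt0.
  have := half_ball u; have := half_ball v; rewrite -/m => h1 h2.
  have := cardsUI (ball E m [set u]%SET) (ball E m [set v]%SET).
  have : #|(ball E m [set u] :|: ball E m [set v])%SET| <= #|V| by exact: max_card.
  move: h1 h2; move: #|V| #|ball E m [set u]%SET| #|ball E m [set v]%SET| #|(_ :|: _)%SET|.
  by move: #|(_ :&: _)%SET|; clear; lia.
rewrite inE => /andP[wu /ball_sym wv]; rewrite mul2n -addnn.
exact: ball_cat wu wv.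
Qed.

Lemma expander_rainbow_connectivity :
  let rho := 2 * (r * D * (trunc_log 2 #|V|).+1) in
  0 < #|V| ->
  graph_connected E /\ rainbow_connectivity E <= rho * (3 * rho + 1).
Proof.
move=> rho /card_gt0P[u _]; have [sE _] := regularP _ _ hE.
have hc := radius_rainbow_colorable sE expander_cut2 (expander_radius u).
split.
  case: hc => c [_ rc]; apply/forallP => x; apply/forallP => y.
  by have [p [pp lp _ _]] := rc x y; apply/connectP; exists p.
rewrite /rainbow_connectivity; case: ex_minnP => m _; apply.
by apply/implyP => _; apply/asboolP.
Qed.

End ExpanderRadius.

(** * Existence of regular graphs *)

Section Circulant.
Variables (m : nat) (D : {set 'I_m.+1}).
Hypotheses (D0 : (0 : 'I_m.+1)%R \notin D) (DN : forall d, d \in D -> (- d)%R \in D).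

(** A Cayley graph of the integers modulo m + 1. It shows that regular graphs exist, so that the
    probabilities are not 0 by default. *)
Definition circulant : {set {set 'I_m.+1}} :=
  [set e | [exists x, exists y, ((y - x)%R \in D) && (e == [set x; y]%SET)]]%SET.

Lemma adj_circulant (x y : 'I_m.+1) : adj circulant x y = ((y - x)%R \in D).
Proof.
rewrite /adj inE; apply/existsP/idP => [[x' /existsP[y' /andP[xyD e]]]|xyD].
  have xy' : x' != y' by apply: contraNneq D0 => h; rewrite h subrr in xyD.
  have := eq_set2 x y xy'; rewrite e !mulnb.
  case: andP => [[/eqP -> /eqP -> //]|_]; case: andP => // -[/eqP -> /eqP ->] _.
  by rewrite -opprB DN.
by exists x; apply/existsP; exists y; rewrite xyD eqxx.
Qed.

Lemma circulant_regular : circulant \in regular 'I_m.+1 #|D|.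
Proof.
apply/regularP; split=> [|x].
  apply/forall_inP => e; rewrite inE => /existsP[x /existsP[y /andP[xyD /eqP ->]]].
  have xy : x != y by apply: contraNneq D0 => h; rewrite h subrr in xyD.
  by rewrite cards2 xy.
under eq_bigr do rewrite adj_circulant.
rewrite (reindex_inj (addrI x)) /= -sum1_card [RHS]big_mkcond /=.
by apply: eq_bigr => d _; rewrite addrC addKr.
Qed.

End Circulant.

Lemma sum_interval (n a b : nat) :
  \sum_(i < n) (a <= i < b : nat) = minn n b - minn n a.
Proof.
elim: n => [|n IHn]; first by rewrite big_ord0 !min0n.
by rewrite big_ord_recr /= IHn; case: leqP; case: ltnP; lia.
Qed.

Lemma regular_exists (n r : nat) : r < n -> ~~ odd (r * n) ->
  0 < #|regular 'I_n r|.
Proof.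
case: n => // m rm ev.
pose h := r./2; pose n := m.+1.
(* The connection set consists of 1, ..., h and their negatives, and of n / 2 when [r] is odd, in
   which case [n] is even. *)
pose P i := [|| 1 <= i < h.+1, n - h <= i < n | odd r && (n./2 <= i < n./2.+1)].
have rE := odd_double_half r.
have nE : odd r -> n = n./2.*2.
  by move: ev; rewrite oddM => + ro; rewrite ro => ev; exact: (esym (even_halfK ev)).
pose D := [set d : 'I_m.+1 | P d]%SET.
have cD : #|D| = r.
  rewrite cardsE -sum1_card big_mkcond /=.
  transitivity (\sum_(i < n) (1 <= i < h.+1 : nat) + \sum_(i < n) (n - h <= i < n : nat) +
      \sum_(i < n) (odd r * (n./2 <= i < n./2.+1))).
    rewrite -!big_split; apply: eq_bigr => i _.
    rewrite unfold_in /=.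
    have -> : (if P i then 1 else 0) = P i :> nat by case: (P i).
    have := ltn_ord i; rewrite -/n /P; move: (nat_of_ord i) (n./2) nE => j c nE.
    by case: (odd r) nE rE => [/(_ isT)|_]; rewrite -/h; lia.
  rewrite -big_distrr /= !sum_interval.
  by case: (odd r) nE rE => [/(_ isT)|_]; rewrite -/h; lia.
rewrite -cD; apply/card_gt0P; exists (circulant D); apply: circulant_regular.
  rewrite inE /P /=.
  by case: (odd r) nE rE => [/(_ isT)|_]; rewrite -/h; lia.
move=> d; rewrite !inE.
have -> : ((- d)%R : 'I_m.+1) = (n - d) %% n :> nat by [].
have [d0|d0] := posnP d.
  by rewrite d0 subn0 modnn.
rewrite modn_small; last by rewrite ltn_subrL d0.
have := ltn_ord d; rewrite -/n /P.
by case: (odd r) nE rE => [/(_ isT)|_]; rewrite -/h; lia.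
Qed.

(** * The random regular graph *)

Local Open Scope ring_scope.

(** From exp(-1/2) >= 1 - 1/2. *)
Lemma half_le_ln2 (R : realType) : 2^-1 <= ln 2 :> R.
Proof.
rewrite -ler_expR lnK ?posrE //; have := @expR_ge1Dx R (- 2^-1).
rewrite expRN => h.
have : (2^-1 : R) <= (expR 2^-1)^-1 by apply: le_trans h; lra.
by rewrite lef_pV2 ?posrE ?expR_gt0.
Qed.

Lemma trunc_log_le_ln (R : realType) (n : nat) : (0 < n)%N ->
  (trunc_log 2 n)%:R <= 2 * ln n%:R :> R.
Proof.
move=> n0; set L := trunc_log 2 n.
have h : (2 ^ L)%:R <= n%:R :> R by rewrite ler_nat trunc_logP.
have : ln (2 ^ L)%:R <= ln n%:R :> R.
  by rewrite ler_ln ?posrE ?ltr0n ?expn_gt0.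
rewrite natrX lnXn // => h'.
rewrite -(mulr_natr (ln _)) in h'.
have : 2^-1 * L%:R <= ln 2 * L%:R :> R by apply: ler_wpM2r (half_le_ln2 R).
lra.
Qed.

(** For r >= 4 the exponent is at least 2, since ln (r - 1) >= ln (r - 2) > 0; for r = 3 it is 4. *)
Lemma ln_sqr_le_rate (R : realType) (r n : nat) : (3 <= r)%N -> 1 <= ln n%:R :> R ->
  ln n%:R ^+ 2 <= rc_rate R r n.
Proof.
move=> hr h1; rewrite /rc_rate; case: eqP => [_|r3].
  exact: ler_weXn2l.
have r4 : (4 <= r)%N by lia.
rewrite -powR_mulrn ?(le_trans ler01) //; apply: ler_powR => //.
have r4' : 4 <= r%:R :> R by rewrite (ler_nat R 4).
have l2 : 0 < ln (r%:R - 2) :> R by apply: ln_gt0; lra.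
rewrite ler_peMr // /theta ler_pdivlMr // mul1r ler_ln ?posrE; lra.
Qed.

Lemma expander_rc_le_rate (R : realType) (r D n : nat) (E : {set {set 'I_n}}) :
  (3 <= r)%N -> (0 < D)%N -> (4 <= n)%N -> E \in regular 'I_n r ->
  expander D E ->
  graph_connected E /\
  (rainbow_connectivity E)%:R <= ((4 * (8 * (r * D)) ^ 2)%N)%:R * rc_rate R r n.
Proof.
move=> hr D0 n4 hE hexp.
have r0 : (0 < r)%N by apply: leq_trans hr.
have n0 : (0 < #|'I_n|)%N by rewrite card_ord; apply: leq_trans n4.
have [conn rc] := expander_rainbow_connectivity hE hexp r0 D0 n0.
split=> //; rewrite card_ord in rc.
set L := trunc_log 2 n in rc.
have L2 : (2 <= L)%N by rewrite trunc_log_max.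
have ln1 : 1 <= ln n%:R :> R.
  have h : 4 <= n%:R :> R by rewrite (ler_nat R 4).
  have : ln (2 ^+ 2) <= ln n%:R :> R.
    by rewrite ler_ln ?posrE ?exprn_gt0 //; [lra|rewrite ltr0n (leq_trans _ n4)].
  by rewrite lnXn // -(mulr_natr (ln _)); have := half_le_ln2 R; lra.
have LR := trunc_log_le_ln R (leq_trans (isT : 0 < 4)%N n4).
rewrite -/L in LR.
(* With a = 2 r D (L + 1) <= 4 r D L one has a (3 a + 1) <= 4 a^2, and L <= 2 ln n then turns the 4
   r D L into 8 r D ln n. *)
apply: (@le_trans _ _ ((4 * (4 * (r * D) * L) ^ 2)%N)%:R).
  rewrite ler_nat; apply: leq_trans rc _.
  set a := (2 * (r * D * L.+1))%N.
  have aL : (a <= 4 * (r * D) * L)%N.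
    rewrite /a; move: (r * D)%N L2 => q; clear; nia.
  have : (a * (3 * a + 1) <= 4 * a ^ 2)%N.
    by rewrite expnS expn1; move: a {aL}; clear; nia.
  by move=> /leq_trans; apply; rewrite leq_mul2l leq_expl.
rewrite !(natrM _ 4 (_ ^ 2)) !natrX -mulrA ler_pM2l ?ltr0n //.
rewrite (natrM _ _ L).
apply: (@le_trans _ _ (((8 * (r * D))%N)%:R ^+ 2 * ln n%:R ^+ 2)); last first.
  by rewrite ler_wpM2l ?ln_sqr_le_rate // exprn_ge0.
rewrite -exprMn; apply: lerXn2r; rewrite ?nnegrE ?mulr_ge0 // ?(le_trans ler01) //.
have -> : (8 * (r * D) = 4 * (r * D) * 2)%N by lia.
by rewrite (natrM _ _ 2) -mulrA; apply: ler_wpM2l.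
Qed.

Theorem theorem2 (R : realType) (r : nat) (hr : (3 <= r)%N) :
  exists C : R,
    whp_regular R r (fun n G =>
      graph_connected G &&
      ((rainbow_connectivity G)%:R <= C * rc_rate R r n)).
Proof.
have [n0 numeric] := large_numeric hr.
set s1 := (512 * r ^ 3)%N in numeric.
have s1_gt0 : (0 < s1)%N by rewrite muln_gt0 expn_gt0 (leq_trans _ hr).
exists ((4 * (8 * (r * s1)) ^ 2)%N)%:R.
set K := (2 * s1 * ((r * s1).+2 ^ 2) ^ s1 + 4)%N.
apply/cvgrPdist_lt => e e0; rewrite near_withinE.
(* The failure probability is at most K / n, so n > K / e is required, besides the ranges of the
   estimates and r < n for existence. *)
pose N := (n0 + 4 * (r * s1) * r ^ 2 + r.+1 + 4 + Num.bound (K%:R / e))%N.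
exists N => //= n Nn0 ev; have Nn : (N <= n)%N := Nn0.
have n4 : (4 <= n)%N by move: Nn; rewrite /N; clear; lia.
have rn : (r < n)%N by move: Nn; rewrite /N; clear; lia.
have R0 := regular_exists rn ev.
have hN : (n0 + 4 * (r * s1) * r ^ 2 <= #|'I_n|)%N.
  by rewrite card_ord; move: Nn; rewrite /N; clear; lia.
have nn0 : (n0 <= n)%N by move: Nn; rewrite /N; clear; lia.
have hb : K%:R / e < n%:R.
  apply: lt_le_trans (archi_boundP _) _; first by rewrite divr_ge0 // ltW.
  by rewrite ler_nat; move: Nn; rewrite /N; clear; lia.
have hbad := @card_expander_compl 'I_n r hr n0.
rewrite card_ord in hbad; have {}hbad := hbad (fun s _ => numeric n s nn0).
rewrite card_ord in hN; have {}hbad := hbad hN.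
rewrite -/s1 -/K in hbad.
rewrite /Pr_regular; set Q := finset _; set Reg := regular_graphs n r.
have eReg : Reg = regular 'I_n r by [].
have QR : Q \subset Reg by apply/fintype.subsetP => E; rewrite inE => /andP[].
have compl : (#|(Reg :\: Q)%SET| <= #|[set E in regular 'I_n r | ~~ expander s1 E]%SET|)%N.
  apply/subset_leq_card/fintype.subsetP => E; rewrite finset.in_setD !inE -!andbA.
  case/andP => nQ /andP[ER1 ER2]; rewrite ER1 ER2 /=.
  apply: contra nQ => hexp; rewrite ER1 ER2 /=.
  have ER : E \in regular 'I_n r by rewrite inE ER1.
  have [-> /=] := expander_rc_le_rate R hr s1_gt0 n4 ER hexp.
  by [].
have card_split : #|Reg|%:R = #|Q|%:R + #|(Reg :\: Q)%SET|%:R :> R.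
  by rewrite -natrD -(cardsID Q Reg) (finset.setIidPr QR).
have Rp : 0 < #|Reg|%:R :> R by rewrite ltr0n.
have -> : 1 - #|Q|%:R / #|Reg|%:R = #|(Reg :\: Q)%SET|%:R / #|Reg|%:R :> R.
  rewrite -{1}(divff (lt0r_neq0 Rp)) -mulrBl; congr (_ / _).
  by rewrite card_split; lra.
rewrite ger0_norm ?divr_ge0 // ltr_pdivrMr //.
have n_gt0 : 0 < n%:R :> R by rewrite ltr0n (leq_trans _ n4).
rewrite -(ltr_pM2l n_gt0).
have : (n * #|(Reg :\: Q)%SET| <= K * #|Reg|)%N.
  by apply: leq_trans hbad; rewrite leq_mul2l compl orbT.
rewrite -(ler_nat R) !natrM => /le_lt_trans; apply.
rewrite mulrA ltr_pM2r //.
by rewrite ltr_pdivrMr in hb.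
Qed.
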